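(* Assume that the function $A$ is increasing on $[0,1]$. (1) Let $T>0$, possibly $T=+\infty$. Let $F^1, F^2 \in \mathcal{F}(T)$ be such that for all $g \in C^\infty_{\mathrm{c}}([0,T)\times\mathbb{R})$, both $F=F^1$ and $F=F^2$ satisfy, for all $t\in[0,T)$, $$\int_{\mathbb{R}} g(t,x)F_t(x)\,\mathrm{d}x - \int_{\mathbb{R}} g(0,x)H*m(x)\,\mathrm{d}x = \int_{\mathbb{R}}\int_0^t \left\{\tfrac12 A(F_s(x))\partial_x^2 g(s,x) + B(F_s(x))\partial_x g(s,x) + F_s(x)\partial_s g(s,x)\right\}\mathrm{d}s\,\mathrm{d}x.$$ Then $F^1 = F^2$ in $\mathcal{F}(T)$. (2) There is at most one weak solution to the Cauchy problem in $\mathcal{F} = \mathcal{F}(+\infty)$.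
   Context: Let $a,b : [0,1] \to \mathbb{R}$ be continuous with $a \geq 0$; set $A(u) = \int_0^u a(v)\,\mathrm{d}v$ and $B(u) = \int_0^u b(v)\,\mathrm{d}v$. Let $m$ be a probability distribution on $\mathbb{R}$. For a probability distribution $\mu$ on $\mathbb{R}$, $H*\mu(x) = \mu((-\infty,x])$ is its cumulative distribution function. $\mathcal{P}(\mathbb{R})$ is the set of Borel probability distributions on $\mathbb{R}$ with the topology of weak convergence. The Cauchy problem is $$\partial_t F_t(x) = \tfrac12 \partial_x^2\big(A(F_t(x))\big) - \partial_x\big(B(F_t(x))\big), \qquad F_0(x) = H*m(x), \qquad (t,x)\in[0,+\infty)\times\mathbb{R}.$$ A weak solution is a continuous mapping $F : t \in [0,+\infty) \mapsto F_t \in L^1_{\mathrm{loc}}(\mathbb{R})$ such that for all $t\ge0$, $F_t$ takes its values in $[0,1]$ and the integral identity displayed in the claim holds for all $t \ge 0$ and all $g \in C^\infty_{\mathrm{c}}([0,+\infty)\times\mathbb{R})$. For $T \in (0,+\infty]$, $\mathcal{P}_1(T)$ is the set of continuous mappings $t \in [0,T) \mapsto P(t) \in \mathcal{P}(\mathbb{R})$ such that for all $t\in[0,T)$, $P(t)$ has a finite first order moment and the function $t \mapsto \int_{\mathbb{R}}|x|P(t)(\mathrm{d}x)$ is locally integrable on $[0,T)$; $\mathcal{F}(T) := \{F : (t,x)\mapsto (H*P(t))(x) \,;\, P \in \mathcal{P}_1(T)\}$. *)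

(* Defs.v *)
From HB Require Import structures.
From mathcomp Require Import all_boot all_order all_algebra.
From mathcomp Require Import all_classical all_reals all_analysis.

Set Implicit Arguments.
Unset Strict Implicit.
Unset Printing Implicit Defensive.

Import Order.TTheory GRing.Theory Num.Theory.
Import numFieldNormedType.Exports.

Local Open Scope classical_set_scope.
Local Open Scope ring_scope.

Section defs.
Context {R : realType}.
Notation mu := (@lebesgue_measure R).

Definition primitive0 (f : R -> R) (u : R) : R :=
  \int[mu]_(v in `[0, u]) f v.

Definition Hcdf (P : probability (measurableTypeR R) R) (x : R) : R :=
  fine (P [set` `]-oo, x]]).

(* The weak topology on the Borel probability distributions on R is the
   coarsest one that makes P |-> \int f dP continuous for every bounded
   continuous f. *)
Definition bounded_continuous : Type :=
  {f : R -> R | continuous f /\ exists M : R, forall x, `|f x| <= M}.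

Definition integrals_against (P : probability (measurableTypeR R) R) :
    prod_topology (fun _ : bounded_continuous => R) :=
  fun f => \int[P]_x (projT1 f x).

Definition weak_probability : topologicalType :=
  initial_topology integrals_against.

Lemma cvg_weak_probability (F : set_system weak_probability) (FF : Filter F)
    (P : weak_probability) :
  F --> P <-> (forall f : bounded_continuous,
    (fun Q => integrals_against Q f) @ F --> integrals_against P f).
Proof.
have sproj (f : bounded_continuous) :
    (fun z : bounded_continuous -> R => z f) @` setT = setT.
  by apply/seteqP; split => // y _ /=; exists (fun _ => y).
split=> [h f|h].
  have : integrals_against @ F --> integrals_against P.
    exact: cvg_trans (cvg_app _ h)
      (@initial_continuous _ _ integrals_against P).
  move/cvg_sup => /(_ f).
  have c := @initial_continuous _ _ (fun z : bounded_continuous -> R => z f)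
    (integrals_against P).
  move=> g; apply: cvg_trans c; exact: (cvg_app _ g).
have hc : integrals_against @ F --> integrals_against P.
  apply/cvg_sup => f.
  apply/cvg_image; first exact: sproj.
  move=> A /(h f) hA.
  exists ((fun z : bounded_continuous -> R => z f) @^-1` A) => //.
  by rewrite image_preimage.
move=> A [_ [[C oC <-] CP BA]].
apply: (filterS BA).
by apply: hc; apply: open_nbhs_nbhs; split.
Qed.

Definition time_interval (T : \bar R) : set R :=
  [set t | 0 <= t /\ (t%:E < T)%E].

(* A path is a function on R of which only the restriction to [0, T) matters. *)
Definition P1 (T : \bar R) (P : R -> probability (measurableTypeR R) R) : Prop :=
  [/\ {within time_interval T, continuous (P : R -> weak_probability)},
      forall t, time_interval T t -> (\int[P t]_x `|x|%:E < +oo)%E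
    & forall K : set R, K `<=` time_interval T -> compact K ->
        mu.-integrable K (fun t => (\int[P t]_x `|x|%:E)%E)].

Definition FT (T : \bar R) : set (R -> R -> R) :=
  [set F | exists2 P, P1 T P &
     forall t, time_interval T t -> forall x, F t x = Hcdf (P t) x].

Definition dt (g : R * R -> R) : R * R -> R := 'D_((1, 0) : R * R) g.
Definition dx (g : R * R -> R) : R * R -> R := 'D_((0, 1) : R * R) g.

Fixpoint Ck (k : nat) (g : R * R -> R) : Prop :=
  continuous g /\
  if k is k'.+1 then
    [/\ forall p, derivable g p (1, 0), forall p, derivable g p (0, 1),
        Ck k' (dt g) & Ck k' (dx g)]
  else True.

(* C^oo_c([0, T) x R): as usual on a set with boundary, smooth functions on
   [0, T) x R are restrictions of smooth functions, here defined on the whole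
   plane, so that the derivatives at time 0 are those of the extension. The
   values of g at negative times are irrelevant. *)
Definition test_function (T : \bar R) (g : R * R -> R) : Prop :=
  let support := closure [set p : R * R | 0 <= p.1 /\ g p != 0] in
  [/\ forall k, Ck k g, compact support
    & support `<=` [set p | time_interval T p.1]].

Definition weak_identity (a b : R -> R) (m : probability (measurableTypeR R) R)
    (F : R -> R -> R) (g : R * R -> R) (t : R) : Prop :=
  \int[mu]_x (g (t, x) * F t x) - \int[mu]_x (g (0, x) * Hcdf m x) =
  \int[mu]_x (\int[mu]_(s in `[0, t])
    (2^-1 * primitive0 a (F s x) * dx (dx g) (s, x)
     + primitive0 b (F s x) * dx g (s, x)
     + F s x * dt g (s, x))).

(* Continuity of t |-> F_t for the topology of L^1_loc(R), where F_t is given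
   by a representative. *)
Definition continuous_L1loc (D : set R) (F : R -> R -> R) : Prop :=
  (forall t, D t -> locally_integrable [set: R] (F t)) /\
  (forall K : set R, compact K -> forall t0, D t0 ->
    (\int[mu]_(x in K) `|F t x - F t0 x|) @[t --> within D (nbhs t0)]
      --> (0 : R)).

(* In the iterated integral, F is one given function of (t, x): modifying each
   F_t on a null set could destroy measurability in time. The elements of FT T
   are jointly measurable on [0, T) x R. *)
Definition weak_solution (a b : R -> R) (m : probability (measurableTypeR R) R)
    (F : R -> R -> R) : Prop :=
  [/\ continuous_L1loc (time_interval +oo%E) F,
      forall t, time_interval +oo%E t -> forall x, 0 <= F t x <= 1
    & forall g, test_function +oo%E g ->
        forall t, time_interval +oo%E t -> weak_identity a b m F g t].

End defs.

Arguments weak_probability R : clear implicits.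

(* Main.v *)
Require Import Defs.
From HB Require Import structures.
From mathcomp Require Import all_boot all_order all_algebra.
From mathcomp Require Import all_classical all_reals all_analysis.
From mathcomp Require Import measurable_realfun ring lra.

(** Two solutions are compared through the primitive in space of their
    difference. Write [D t = F1 t - F2 t], and let [M t] and [N t] be the time
    integrals over [[0, t]] of [(A F1 - A F2) / 2] and [B F1 - B F2]. Testing the
    two integral identities with the product of a time cut-off and a smooth
    function of space, and subtracting, shows that [D t] is the second derivative
    of [M t] minus the first derivative of [N t], as distributions. Hence
    [D t] has a primitive [G t] such that the derivative of [M t] is [G t + N t]
    ([potential_exists]). Since [M t] and [N t] are bounded and [G t] is
    1-Lipschitz, averaging over unit intervals bounds [G t] uniformly.

    In time, [G] formally solves [d_t G = d_x (A F1 - A F2) / 2 - (B F1 - B F2)].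
    It satisfies a maximum principle, obtained by letting [lam] tend to infinity
    in the energies [E t = int exp (lam * G t) w], where [w] is an integrable
    weight with logarithmic derivative at most [1 / c]. The convexity of the
    exponential bounds [E t - E s] by the integral of
    [lam * exp (lam * G t) * (G t - G s) * w], which only involves increments in time;
    an integration by parts in space ([energy_step]) and a passage to the limit
    [s -> t] show that [E] grows at most at the rate
    [lam * int exp (lam * G) w (- lam / 2 * D * (A F1 - A F2) + |B F1 - B F2| + O(1 / c))].

    The strict monotonicity of [A] is used at this point: by compactness, for
    every [delta > 0] there is [lam0] such that
    [|B u - B v| <= delta + lam0 * (u - v) * (A u - A v)]
    ([convection_le_diffusion]). For [lam] large the diffusion therefore absorbs
    the convection up to [delta], and a comparison lemma bounds [E t] by a constant
    times [exp ((lam * kappa + 1) * t)], with [kappa] as small as desired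
    ([potential_energy_bound]). On the other hand [E t] is at least of order
    [exp (lam * G t x) / lam], because [G t] is 1-Lipschitz. Letting [lam] tend to
    infinity yields [G t <= 0] ([potential_le0]); exchanging the two solutions yields
    [G t = 0], hence [D t = 0] by right-continuity.

    Distribution functions may jump, and weak continuity in time gives their
    convergence only at points of continuity. Their jumps are countably many, so
    all the pointwise limits hold almost everywhere, and dominated convergence
    applies. *)

Set Implicit Arguments.
Unset Strict Implicit.

Import Order.TTheory GRing.Theory Num.Theory.
Import numFieldNormedType.Exports.

Local Open Scope classical_set_scope.
Local Open Scope ring_scope.


(** * Integration on the line *)
Lemma Rintegral_dominated_cvg d (T : measurableType d) (R : realType)
    (m : {measure set T -> \bar R}) (D : set T) (f_ : nat -> T -> R)
    (f g : T -> R) :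
  measurable D -> (forall n, measurable_fun D (f_ n)) -> measurable_fun D f ->
  {ae m, forall x, D x -> f_ n x @[n --> \oo] --> f x} ->
  m.-integrable D (EFin \o g) -> (forall n x, D x -> `|f_ n x| <= g x) ->
  \int[m]_(x in D) f_ n x @[n --> \oo] --> \int[m]_(x in D) f x.
Proof.
move=> mD mf_ mf cvf ig fg.
have [] := @dominated_convergence _ _ _ m D mD (fun n x => (f_ n x)%:E)
  (EFin \o f) (EFin \o g).
- by move=> n; exact/measurable_EFinP.
- exact/measurable_EFinP.
- apply: filterS cvf => x h Dx; apply/fine_cvgP; split.
    by near=> n.
  exact: (h Dx).
- exact: ig.
- by apply: aeW => x n Dx; rewrite /= lee_fin; exact: fg.
move=> ifm _ h.
apply: fine_cvg; rewrite fineK //.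
exact: integrable_fin_num.
Unshelve. all: by end_near. Qed.

Section line.
Context {R : realType}.
Notation mu := (@lebesgue_measure R).

(** Two properties of this integrable weight are used throughout: its
    logarithmic derivative is at most [1 / c], hence negligible when [c] is
    large, and it changes by a bounded factor under unit shifts. *)
Definition weight (c x : R) : R := (c ^+ 2 + x ^+ 2)^-1.

Lemma weight_den_gt0 c x : 1 <= c -> 0 < c ^+ 2 + x ^+ 2 :> R.
Proof. by move=> c1; rewrite ltr_wpDr ?sqr_ge0// exprn_gt0// (lt_le_trans ltr01). Qed.

Lemma weight_gt0 c x : 1 <= c -> 0 < weight c x.
Proof. by move=> c1; rewrite invr_gt0 weight_den_gt0. Qed.

Lemma weight_le1 c x : 1 <= c -> weight c x <= weight 1 x.
Proof.
move=> c1; rewrite /weight lef_pV2 ?posrE ?weight_den_gt0// lerD2r expr1n.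
by rewrite -[leLHS](expr1n _ 2) lerXn2r ?nnegrE// (le_trans ler01).
Qed.

Lemma weightE1 x : weight 1 x = (oneDsqr x)^-1.
Proof. by rewrite /weight expr1n. Qed.

Lemma continuous_weight c : 1 <= c -> continuous (weight c).
Proof.
move=> c1 x; apply: cvgV; first by rewrite gt_eqF// weight_den_gt0.
by apply: cvgD; [exact: cvg_cst|exact: exprn_continuous].
Qed.

Lemma integrable_weight1 : mu.-integrable setT (EFin \o weight 1).
Proof.
have mw : measurable_fun setT (weight 1).
  by apply: continuous_measurable_fun; exact: continuous_weight.
apply/integrableP; split; first exact/measurable_EFinP.
under eq_integral => x _.
  rewrite /= ger0_norm ?(ltW (weight_gt0 _ _))//; over.
rewrite ge0_symfun_integralT; last 3 first.
- by move=> x; rewrite ltW// weight_gt0.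
- exact: continuous_weight.
- by move=> x; rewrite /weight /= sqrrN.
rewrite -set_itvcy.
under eq_integral do rewrite weightE1.
by rewrite integral0y_oneDsqr -EFinM ltry.
Qed.

Lemma integrable_le_weight (f : R -> R) (C : R) : measurable_fun setT f ->
  (forall x, `|f x| <= C * weight 1 x) -> mu.-integrable setT (EFin \o f).
Proof.
move=> mf fC.
have := integrableZl measurableT C integrable_weight1.
apply: le_integrable => //; first exact/measurable_EFinP.
by move=> x _; rewrite /= lee_fin (le_trans (fC x))// ler_norm.
Qed.

Lemma line_dominated_cvg (f_ : nat -> R -> R) (f : R -> R) C :
  (forall n, measurable_fun setT (f_ n)) -> measurable_fun setT f ->
  {ae mu, forall x, f_ n x @[n --> \oo] --> f x} ->
  (forall n x, `|f_ n x| <= C * weight 1 x) ->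
  \int[mu]_x f_ n x @[n --> \oo] --> \int[mu]_x f x.
Proof.
move=> mf_ mf cvf fC.
apply: (@Rintegral_dominated_cvg _ _ _ mu setT f_ f (fun x => C * weight 1 x)) => //.
  move: cvf; apply: filterS; first exact: (ae_filter_ringOfSetsType mu).
  by move=> x h _.
exact: (integrableZl measurableT C integrable_weight1).
Qed.

Lemma lebesgue_measure_shift h A : measurable A ->
  mu A = pushforward mu (fun x : R => x + h) A.
Proof.
move=> mA.
have mp : measurable_fun setT ((fun x => x + h) : measurableTypeR R -> measurableTypeR R).
  by apply: measurable_funD.
pose mp_mixin := isMeasurableFun.Build _ _ _ _ _ mp.
pose phi : {mfun (measurableTypeR R) >-> (measurableTypeR R)} := HB.pack (fun x : R => x + h) mp_mixin.
apply: (@lebesgue_measure_unique R (pushforward mu phi)) => //.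
move=> X /= [[a b] /= _ <-]; rewrite /pushforward /=.
rewrite (_ : (fun x : R => x + h) @^-1` `]a, b] = `]a - h, b - h]%classic); last first.
  by apply/seteqP; split => x /=; rewrite !in_itv /= ltrBlDr lerBrDr.
rewrite !lebesgue_measure_itv /= !lte_fin ltrD2r.
by case: ifP => // _; rewrite -!EFinB opprB addrA subrK.
Qed.

(** Discrete integration by parts rests on this invariance: it moves a
    difference quotient from one factor of a product to the other. *)
Lemma Rintegral_shift (f : R -> R) h : measurable_fun setT f ->
  mu.-integrable setT (EFin \o (fun x => f (x + h))) ->
  \int[mu]_x f (x + h) = \int[mu]_x f x.
Proof.
move=> mf If; rewrite /Rintegral; congr fine.
have mp : measurable_fun setT ((fun x => x + h) : measurableTypeR R -> measurableTypeR R).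
  by apply: measurable_funD.
have /= := @integral_pushforward _ _ _ _ R _ mp mu setT (EFin \o f).
rewrite preimage_setT => /(_ _ If measurableT) /= <-; last exact/measurable_EFinP.
apply: eq_measure_integral => A mA _.
by rewrite [RHS](lebesgue_measure_shift h).
Qed.
End line.

(** * Primitives and right-continuous functions *)
Section primitives.
Context {R : realType}.
Notation mu := (@lebesgue_measure R).
Implicit Types (f g : R -> R) (a b x y z C : R).

(** Half-open intervals tile without overlap, which makes the additivity of
    primitives an exact equality. *)
Definition segment_integrable f :=
  forall a b, mu.-integrable `]a, b] (EFin \o f).

Lemma bounded_integrable (A : set R) f C : measurable A -> (mu A < +oo)%E ->
  measurable_fun A f -> (forall x, A x -> `|f x| <= C) ->
  mu.-integrable A (EFin \o f).
Proof.
move=> mA Aoo mf fC; apply: measurable_bounded_integrable => //.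
exists C; split; first exact: num_real.
by move=> M CM x Ax; exact: le_trans (fC x Ax) (ltW CM).
Qed.

Lemma lebesgue_itv_lty a b (i j : bool) :
  (mu [set` Interval (BSide i a) (BSide j b)] < +oo)%E.
Proof.
by rewrite lebesgue_measure_itv /=; case: ifP => // _; rewrite -EFinB ltry.
Qed.

Lemma bounded_segment_integrable f C : measurable_fun setT f ->
  (forall x, `|f x| <= C) -> segment_integrable f.
Proof.
move=> mf fC a b; apply: (@bounded_integrable _ _ C) => //.
- exact: lebesgue_itv_lty.
- exact: measurable_funTS.
Qed.

Lemma continuous_segment_integrable f : continuous f -> segment_integrable f.
Proof.
move=> cf a b; apply: (@integrableS _ _ _ mu `[a, b]) => //.
  exact: subset_itv_oc_cc.
apply: continuous_compact_integrable; first exact: segment_compact.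
exact: continuous_subspaceT.
Qed.

Lemma segment_integrableD f g : segment_integrable f -> segment_integrable g ->
  segment_integrable (fun x => f x + g x).
Proof.
move=> If Ig a b.
apply: (@eq_integrable _ _ _ mu _ _ ((EFin \o f) \+ (EFin \o g))%E) => //.
by apply: integrableD.
Qed.

Lemma Rintegral_bound f a b C : a <= b -> measurable_fun `]a, b] f ->
  (forall x, a < x <= b -> `|f x| <= C) ->
  `|\int[mu]_(x in `]a, b]) f x| <= C * (b - a).
Proof.
move=> ab mf fC.
have fC' x : `]a, b]%classic x -> `|f x| <= C.
  by rewrite /= in_itv /=; exact: fC.
have If : mu.-integrable `]a, b] (EFin \o f).
  by apply: (@bounded_integrable _ _ C) => //; exact: lebesgue_itv_lty.
have Ic : mu.-integrable `]a, b] (EFin \o cst C).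
  by apply: (@bounded_integrable _ _ `|C|) => //; exact: lebesgue_itv_lty.
apply: (le_trans (le_normr_Rintegral _ If)) => //.
apply: (@le_trans _ _ (\int[mu]_(x in `]a, b]) C)).
  apply: le_Rintegral => //.
  exact: (integrable_norm If).
rewrite Rintegral_cst//= lebesgue_measure_itv /= lte_fin.
move: ab; rewrite le_eqVlt => /predU1P[->|->]; first by rewrite ltxx subrr.
by [].
Qed.

Lemma Rintegral_chasles f a b c : segment_integrable f -> a <= b -> b <= c ->
  \int[mu]_(x in `]a, c]) f x =
  \int[mu]_(x in `]a, b]) f x + \int[mu]_(x in `]b, c]) f x.
Proof.
move=> If ab bc; apply/eqP; rewrite addrC -subr_eq; apply/eqP.
by rewrite Rintegral_itvB ?bnd_simp.
Qed.

Lemma segment_integrableM f q : continuous f -> segment_integrable q ->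
  segment_integrable (fun z => f z * q z).
Proof.
move=> cf Iq a b.
have [C fC] : exists C : R, forall z, a < z <= b -> `|f z| <= C.
  have [ab|/ltW ba] := leP a b; last first.
    by exists 0 => z /andP[az zb]; have := lt_le_trans az (le_trans zb ba); rewrite ltxx.
  have [|c _ hc] := @EVT_max R (fun z => `|f z|) a b ab.
    by apply: continuous_subspaceT => z; apply: cvg_norm; exact: cf.
  by exists `|f c| => z /andP[/ltW az zb]; apply: hc; rewrite in_itv /= az.
have /integrableP[/measurable_EFinP mq _] := Iq a b.
have mab : measurable (`]a, b]%classic : set (measurableTypeR R)) by [].
have := integrableZl mab C (integrable_norm (Iq a b)).
apply: le_integrable => //.
  apply/measurable_EFinP; apply: measurable_funM => //.
  by apply: measurable_funTS; exact: continuous_measurable_fun.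
move=> z; rewrite /= in_itv /= => zab; rewrite lee_fin normrM [leRHS]normrM normr_id.
by rewrite ler_wpM2r// (le_trans (fC z zab))// ler_norm.
Qed.

Definition prim f x : R :=
  \int[mu]_(z in `]0, x]) f z - \int[mu]_(z in `]x, 0]) f z.

Lemma Rintegral_itv_ge f a b : b <= a -> \int[mu]_(z in `]a, b]) f z = 0.
Proof. by move=> ba; rewrite set_itv_ge ?Rintegral_set0// bnd_simp -leNgt. Qed.

Lemma prim0 f : prim f 0 = 0.
Proof. by rewrite /prim !Rintegral_itv_ge// subrr. Qed.

Lemma primB f x y : segment_integrable f -> x <= y ->
  prim f y - prim f x = \int[mu]_(z in `]x, y]) f z.
Proof.
move=> If xy; rewrite /prim; have [x0|/ltW x0] := leP 0 x.
  have y0 := le_trans x0 xy.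
  rewrite (@Rintegral_itv_ge f y 0)// (@Rintegral_itv_ge f x 0)// !subr0.
  by rewrite (@Rintegral_chasles f 0 x y)// addrC addKr.
have [y0|/ltW y0] := leP y 0.
  rewrite (@Rintegral_itv_ge f 0 x)// (@Rintegral_itv_ge f 0 y)// !sub0r opprK.
  by rewrite (@Rintegral_chasles f x y 0)// addrC addrK.
rewrite (@Rintegral_itv_ge f 0 x)// (@Rintegral_itv_ge f y 0)// subr0 sub0r opprK.
by rewrite (@Rintegral_chasles f x 0 y)// addrC.
Qed.

Lemma mean_cvg f l (u v : nat -> R) : segment_integrable f ->
  (forall n, u n < v n) ->
  (forall e, 0 < e -> \forall n \near \oo,
     forall y, u n < y <= v n -> `|f y - l| <= e) ->
  (v n - u n)^-1 * (\int[mu]_(x in `]u n, v n]) f x) @[n --> \oo] --> l.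
Proof.
move=> If uv h; apply/cvgrPdist_le => e e0; near=> n.
have d0 : 0 < v n - u n by rewrite subr_gt0.
have Ic : segment_integrable (cst l).
  by apply: (@bounded_segment_integrable _ `|l|).
have -> : l - (v n - u n)^-1 * (\int[mu]_(x in `]u n, v n]) f x) =
    - ((v n - u n)^-1 * (\int[mu]_(x in `]u n, v n]) (f x - l))).
  rewrite (RintegralB _ (If _ _) (Ic _ _))//.
  rewrite Rintegral_cst//= lebesgue_measure_itv /= lte_fin uv /=.
  by rewrite mulrBr opprB mulrCA mulVf ?mulr1// gt_eqF.
rewrite normrN normrM gtr0_norm ?invr_gt0// ler_pdivrMl// mulrC.
apply: Rintegral_bound; first exact: ltW.
  apply: measurable_funB => //.
  by have /integrableP[/measurable_EFinP] := If (u n) (v n).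
by near: n; exact: h.
Unshelve. all: by end_near. Qed.

Lemma is_derive_prim (G D : R -> R) x : segment_integrable D ->
  (forall y z, y <= z -> G z - G y = \int[mu]_(t in `]y, z]) D t) ->
  {for x, continuous D} -> is_derive x 1 G (D x).
Proof.
move=> ID GD cD.
pose F y := \int[mu]_(t in `](x - 1), y]) D t.
have [] := @continuous_FTC1 R D (BRight (x - 1)) x (x + 1) _ _ _ cD.
- by rewrite ltrDl.
- exact: ID.
- by rewrite ?ltBSide /= ?lte_fin ltrBlDr ltrDl.
move=> dF eF.
apply: (@near_eq_is_derive _ _ _ (fun y => F y + G (x - 1))).
  near=> y; rewrite /F -GD ?subrK//.
  by apply: ltW; near: y; apply: lt_nbhsr; rewrite ltrBlDr ltrDl.
rewrite -[D x]addr0; apply: is_deriveD.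
by apply: DeriveDef; [exact: dF|rewrite -eF derive1E].
Unshelve. all: by end_near. Qed.

(** A right-continuous function is the limit of its values at the next point
    of the grid of mesh [1 / n.+1], and those approximations are step
    functions. *)
Lemma right_continuous_measurable f :
  (forall x, f z @[z --> x^'+] --> f x) -> measurable_fun setT f.
Proof.
move=> cf.
pose k n x := ((Num.floor (x * n.+1%:R) + 1)%:~R / n.+1%:R : R).
have n0 (n : nat) : 0 < n.+1%:R :> R by rewrite ltr0n.
have kx n x : x < k n x by rewrite /k ltr_pdivlMr// floorD1_gt.
have xk n x : k n x <= x + n.+1%:R^-1.
  rewrite /k ler_pdivrMr// mulrDl mulVf ?gt_eqF// intrD lerD2r.
  exact: floor_le.
apply: (@measurable_fun_cvg _ _ _ _ (fun n x => f (k n x))); last first.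
  move=> x _; have /cvg_at_rightP := cf x; apply; split=> //.
  apply: (@squeeze_cvgr _ _ _ _ (cst x) (fun n => x + n.+1%:R^-1)).
  - by near=> n; rewrite /= xk andbT ltW.
  - exact: cvg_cst.
  - rewrite -[X in _ --> X]addr0; apply: cvgD; first exact: cvg_cst.
    exact: cvg_harmonic.
move=> n _ Y mY; rewrite setTI.
have -> : (fun x => f (k n x)) @^-1` Y = \bigcup_(z : int)
    (if pselect (Y (f ((z + 1)%:~R / n.+1%:R))) then
       `[z%:~R / n.+1%:R, (z + 1)%:~R / n.+1%:R[%classic else set0).
  apply/seteqP; split => [x /= Yx|x [z _]].
    exists (Num.floor (x * n.+1%:R)) => //; case: pselect => //= _.
    by rewrite in_itv /= ler_pdivrMr// floor_le kx.
  case: pselect => //= Yz; rewrite in_itv /= ler_pdivrMr// ltr_pdivlMr// => zx.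
  by rewrite /k (floor_def zx).
apply: countable_bigcupT_measurable => //.
by move=> z; case: pselect => Yz /=; [exact: measurable_itv|exact: measurable0].
Unshelve. all: by end_near. Qed.

Lemma nondecreasing_ae_continuous f : nondecreasing f ->
  (forall x, f z @[z --> x^'+] --> f x) ->
  countable [set x | ~ {for x, continuous f}].
Proof.
move=> ndf cf.
have : [set x | ~ {for x, continuous f}] `<=` \bigcup_(n : nat)
    [set x | x \in (`](- n%:R), n%:R[ : interval R) /\ discontinuity f x].
  move=> x /= ncf; exists (Num.truncn `|x|).+1 => //=; split.
    by rewrite in_itv /= -ltr_norml truncnS_gt.
  have cl : cvg (f z @[z --> x^'-]).
    apply: nondecreasing_at_left_is_cvgr.
    - by near=> y; move=> u v _ _; exact: ndf.
    - near=> y; exists (f x) => _ [u] /= + <-; rewrite in_itv /= => /andP[_ ux].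
      exact/ndf/ltW.
  have cr : cvg (f z @[z --> x^'+]) by apply: cvgP (cf x).
  split=> //; apply/eqP => lr; apply: ncf.
  apply/left_right_continuousP; split; last exact: cf.
  have -> : f x = lim (f z @[z --> x^'-]).
    by rewrite lr; apply/esym/cvg_lim => //; exact: cf.
  exact: cl.
move/subset_card_le/sub_countable; apply; apply: bigcup_countable => // n _.
apply: discontinuity_countable => u v _ _; exact: ndf.
Unshelve. all: by end_near. Qed.

End primitives.

(** * Integration by parts against a Lipschitz function *)
Section ibp.
Context {R : realType}.
Notation mu := (@lebesgue_measure R).
Implicit Types (psi dpsi m q : R -> R).

(** The multiplier [psi] has a derivative almost everywhere only, so the usual
    formula for continuously differentiable functions does not apply. Instead,
    translation invariance gives, for every [h],
    [int psi (m (x + h) - m x) / h = int ((psi (x - h) - psi x) / h) m],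
    and both sides converge by dominated convergence as [h] tends to [0]: the
    left one because the means of the right-continuous [q] converge to [q]. *)
Lemma weighted_ibp psi dpsi m q C :
  measurable_fun setT psi -> measurable_fun setT dpsi ->
  measurable_fun setT m -> measurable_fun setT q ->
  segment_integrable q ->
  (forall x y, x <= y -> m y - m x = \int[mu]_(t in `]x, y]) q t) ->
  (forall x, q z @[z --> x^'+] --> q x) ->
  (forall x, `|psi x * m x| <= C * weight 1 x) ->
  (forall x h, `|h| <= 1 ->
     `|psi x * (m (x + h) - m x)| <= `|h| * (C * weight 1 x)) ->
  (forall x h, `|h| <= 1 ->
     `|(psi (x + h) - psi x) * m x| <= `|h| * (C * weight 1 x)) ->
  {ae mu, forall x, is_derive x (1 : R) psi (dpsi x)} ->
  \int[mu]_x (psi x * q x) = \int[mu]_x (- (dpsi x * m x)).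
Proof.
move=> mpsi mdpsi mm mq Iq mqE cq psim psidm dpsim aed.
pose h n : R := n.+1%:R^-1.
have h0 n : 0 < h n by rewrite invr_gt0 ltr0n.
have h1 n : `|h n| <= 1.
  by rewrite gtr0_norm// invf_le1 ?ltr0n// ler1n.
have hN0 n : h n != 0 by rewrite gt_eqF.
have mshift (f : R -> R) (k : R) : measurable_fun setT f ->
    measurable_fun setT (fun x : R => f (x + k)).
  by move=> mf; apply: (measurableT_comp mf); exact: measurable_funD.
have cvL : \int[mu]_x ((h n)^-1 * (psi x * (m (x + h n) - m x))) @[n --> \oo]
    --> \int[mu]_x (psi x * q x).
  apply: (@line_dominated_cvg _ _ _ C).
  - move=> n; apply: measurable_funM => //; apply: measurable_funM => //.
    by apply: measurable_funB => //; exact: mshift.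
  - exact: measurable_funM.
  - apply: aeW => x.
    under eq_fun do rewrite mulrCA.
    apply: cvgM; first exact: cvg_cst.
    under eq_fun => n.
      rewrite mqE ?lerDl ?ltW// -[X in X^-1](addrK x) (addrC (h n)).
      over.
    apply: mean_cvg => //; first by move=> n; rewrite ltrDl.
    move=> e e0; have /cvgrPdist_le /(_ _ e0) [r /= r0 hr] := cq x.
    near=> n => y /andP[xy yh]; rewrite distrC; apply: hr => //=.
    rewrite distrC gtr0_norm ?subr_gt0// ltrBlDl (le_lt_trans yh)// ltrD2l.
    near: n; have := @cvg_harmonic R; move=> /cvgrPdist_lt /(_ _ r0).
    by apply: filterS => n; rewrite /= sub0r normrN gtr0_norm// /h invr_gt0 ltr0n.
  - move=> n x; rewrite normrM normfV ler_pdivrMl ?normr_gt0//.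
    exact: psidm.
have cvR : \int[mu]_x ((h n)^-1 * ((psi (x + - h n) - psi x) * m x)) @[n --> \oo]
    --> \int[mu]_x (- (dpsi x * m x)).
  apply: (@line_dominated_cvg _ _ _ C).
  - move=> n; apply: measurable_funM => //; apply: measurable_funM => //.
    by apply: measurable_funB => //; exact: mshift.
  - by apply: measurableT_comp => //; exact: measurable_funM.
  - move: aed; apply: filterS; first exact: (ae_filter_ringOfSetsType mu).
    move=> x [dx ex].
    rewrite (_ : (fun n => _) = (fun n => - ((- h n)^-1 *: (psi (- h n *: 1 + x) - psi x) * m x))); last first.
      apply/funext => n.
      have -> : - h n *: (1 : R) + x = x + - h n.
        by rewrite /GRing.scale /= mulr1 addrC.
      by rewrite invrN /GRing.scale /= !mulNr opprK mulrA.
    apply: cvgN; apply: cvgMl.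
    have hl : k^-1 *: (psi (k *: (1 : R) + x) - psi x) @[k --> (0 : R)^'] --> dpsi x.
      by rewrite -ex; exact: dx.
    have /cvgr_dnbhsP := hl; apply; split.
      by move=> n; rewrite oppr_eq0.
    rewrite -oppr0; apply: cvgN; exact: cvg_harmonic.
  - move=> n x; rewrite normrM normfV ler_pdivrMl ?normr_gt0//.
    by have := dpsim x (- h n); rewrite normrN => /(_ (h1 n)).
have Im : mu.-integrable setT (EFin \o (fun x => psi x * m x)).
  by apply: (@integrable_le_weight _ _ C) => //; exact: measurable_funM.
have Ish n : mu.-integrable setT (EFin \o (fun x => psi x * m (x + h n))).
  apply: (@integrable_le_weight _ _ (C + `|h n| * C)).
    by apply: measurable_funM => //; exact: mshift.
  move=> x; rewrite mulrDl -mulrA.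
  rewrite -[m (x + h n)](subrK (m x)) addrC mulrDr.
  by rewrite (le_trans (ler_normD _ _))// lerD// psidm.
have Ish' n : mu.-integrable setT (EFin \o (fun x => psi (x + - h n) * m x)).
  apply: (@integrable_le_weight _ _ (C + `|h n| * C)).
    by apply: measurable_funM => //; exact: mshift.
  move=> x; rewrite mulrDl -mulrA.
  rewrite -[psi (x + _)](subrK (psi x)) addrC mulrDl.
  rewrite (le_trans (ler_normD _ _))// lerD//.
  by have := dpsim x (- h n); rewrite normrN; apply.
have eLR n : \int[mu]_x ((h n)^-1 * (psi x * (m (x + h n) - m x))) =
    \int[mu]_x ((h n)^-1 * ((psi (x + - h n) - psi x) * m x)).
  under eq_Rintegral do rewrite mulrBr.
  under [RHS]eq_Rintegral do rewrite mulrBl.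
  rewrite RintegralZl//; last exact: (integrableB measurableT (Ish n) Im).
  rewrite [RHS]RintegralZl//; last exact: (integrableB measurableT (Ish' n) Im).
  congr (_ * _).
  rewrite (RintegralB _ (Ish n) Im)// (RintegralB _ (Ish' n) Im)//; congr (_ - _).
  rewrite -(@Rintegral_shift _ (fun x => psi (x + - h n) * m x) (h n)).
  - by apply: eq_Rintegral => x _; rewrite addrK.
  - by apply: measurable_funM => //; exact: mshift.
  - by apply: eq_integrable (Ish n) => // x _; rewrite /= addrK.
apply: (cvg_unique _ cvL); first exact: Rhausdorff.
by move/funext: eLR => ->.
Unshelve. all: by end_near. Qed.
End ibp.

(** * Smooth functions of one variable *)
Section smooth.
Context {R : realType}.
Notation mu := (@lebesgue_measure R).
Implicit Types (f g df : R -> R) (k n j : nat) (x y a b c : R).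

(** Carrying the derivative as a witness makes closure under sums, products
    and affine changes of variable immediate by induction. *)
Fixpoint Cn k f : Prop :=
  if k is k'.+1 then
    exists2 df, (forall x, is_derive x (1 : R) f (df x)) & Cn k' df
  else continuous f.

Definition smooth f := forall k, Cn k f.

Lemma is_derive_continuous f df :
  (forall x, is_derive x (1 : R) f (df x)) -> continuous f.
Proof.
by move=> h x; apply/differentiable_continuous/derivable1_diffP; have [] := h x.
Qed.

Lemma Cn_continuous k f : Cn k f -> continuous f.
Proof. by case: k => //= k [df /is_derive_continuous]. Qed.

Lemma CnW k f : Cn k.+1 f -> Cn k f.
Proof.
elim: k f => [|k IH] f; first by move=> /Cn_continuous.
by case=> df fd /IH Cd; exists df.
Qed.

Lemma CnD k f g : Cn k f -> Cn k g -> Cn k (fun x => f x + g x).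
Proof.
elim: k f g => [|k IH] f g /=; first by move=> cf cg x; apply: cvgD; [exact: cf|exact: cg].
move=> [df fd Cf] [dg gd Cg]; exists (fun x => df x + dg x); last exact: IH.
by move=> x; apply: is_deriveD.
Qed.

Lemma CnM k f g : Cn k f -> Cn k g -> Cn k (fun x => f x * g x).
Proof.
elim: k f g => [|k IH] f g; first by move=> cf cg x; apply: cvgM; [exact: cf|exact: cg].
move=> Cf Cg; have Cf' := CnW Cf; have Cg' := CnW Cg.
move: Cf Cg => [df fd Cf] [dg gd Cg].
exists (fun x => f x * dg x + g x * df x); last by apply: CnD; exact: IH.
by move=> x; apply: is_deriveM.
Qed.

Lemma smooth_cst c : smooth (fun=> c).
Proof.
move=> k; elim: k c => [|k IH] c /=; first by move=> x; exact: cvg_cst.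
by exists (fun=> 0) => // x; exact: is_derive_cst.
Qed.

Lemma is_derive_affine f a b x d : is_derive (a * x + b) (1 : R) f d ->
  is_derive x (1 : R) (fun y => f (a * y + b)) (a * d).
Proof.
move=> fd; have h : is_derive x (1 : R) (fun y => a * y + b) a.
  have := is_deriveD (is_deriveZ a (@is_derive_id _ _ x (1 : R))) (is_derive_cst b x 1).
  by rewrite addr0 /GRing.scale /= mulr1.
have := @is_derive1_comp _ f (fun y => a * y + b) x d a fd h.
by rewrite mulrC.
Qed.

Lemma Cn_affine k f a b : Cn k f -> Cn k (fun x => f (a * x + b)).
Proof.
elim: k f => [|k IH] f /=.
  move=> cf x; apply: (@continuous_comp _ _ _ (fun x => a * x + b) f); last exact: cf.
  by apply: cvgD; [apply: cvgM; [exact: cvg_cst|exact: cvg_id]|exact: cvg_cst].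
move=> [df fd Cf]; exists (fun x => a * df (a * x + b)).
  by move=> x; exact: is_derive_affine.
by apply: CnM; [exact: smooth_cst|exact: IH].
Qed.

Lemma smooth_primitive f df : (forall x, is_derive x (1 : R) f (df x)) ->
  smooth df -> smooth f.
Proof.
move=> fd sd [|k]; first exact: (is_derive_continuous fd).
by exists df.
Qed.

(** The derivative of [flat j] is a combination of [flat j.+1] and
    [flat j.+2]; the whole family is therefore smooth by a single induction,
    and [flat 0] is the classical flat function [exp (- 1 / x)]. *)
Definition flat j x : R := if 0 < x then x ^- j * expR (- x^-1) else 0.

(** The exponential series dominates each of its terms; two spare powers of
    [x] give differentiability at the origin. *)
Lemma flat_le j x : `|flat j x| <= (j.+2)`!%:R * x ^+ 2.
Proof.
rewrite /flat; case: ifPn => [x0|_]; last by rewrite normr0 mulr_ge0// ?sqr_ge0.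
rewrite ger0_norm; last by rewrite mulr_ge0 ?expR_ge0// invr_ge0 exprn_ge0// ltW.
have := @expR_ge1Dxn R x^-1 j.+1 (ltW _); rewrite invr_gt0 => /(_ x0) h.
rewrite expRN mulrC -exprVn ler_pdivrMl ?expR_gt0//.
have xp : 0 < x^-1 ^+ j by rewrite exprn_gt0// invr_gt0.
have f0 : 0 < (j.+2)`!%:R :> R by rewrite ltr0n fact_gt0.
apply: le_trans (_ : (x^-1 ^+ j.+2 / (j.+2)`!%:R) * ((j.+2)`!%:R * x ^+ 2) <= _).
  rewrite mulrA divfK ?gt_eqF// -[j.+2]addn2 exprD -mulrA -exprMn mulVf ?gt_eqF//.
  by rewrite expr1n mulr1.
rewrite ler_wpM2r//; first by rewrite mulr_ge0 ?sqr_ge0.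
by apply: le_trans h; rewrite lerDr.
Qed.

Lemma is_derive_flat j x :
  is_derive x (1 : R) (flat j) (- (j%:R * flat j.+1 x) + flat j.+2 x).
Proof.
have [x0|x0|->] := ltgtP x 0.
- rewrite /flat (lt_gtF x0) mulr0 oppr0 addr0.
  apply: (@near_eq_is_derive _ _ _ (cst (0 : R))).
  near=> y; rewrite ltNge (_ : y <= 0)//; near: y; exact: lt_le_nbhsl.
- apply: (@near_eq_is_derive _ _ _ (fun y => y^-1 ^+ j * expR (- y^-1))).
    near=> y; rewrite /flat (_ : 0 < y) ?exprVn//.
    near: y; exact: lt_nbhsr.
  rewrite /flat x0.
  have dV : is_derive x (1 : R) (fun y => y^-1) (- x ^- 2).
    have := @is_deriveV _ id x 1 1 _ (is_derive_id x 1).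
    by rewrite gt_eqF// /GRing.scale /= mulr1 => /(_ isT).
  have dE : is_derive x (1 : R) (fun y => expR (- y^-1)) (expR (- x^-1) * x ^- 2).
    have := is_deriveN dV; rewrite opprK => dN.
    exact: (@is_derive1_comp _ expR (fun y => - y^-1) x _ _ (is_derive_expR _) dN).
  have dX := is_deriveX j dV.
  have := is_deriveM dX dE.
  rewrite /GRing.scale /= exprfctE.
  set l := (X in is_derive _ _ _ X -> _); set r := (X in _ -> is_derive _ _ _ X).
  suff -> : l = r by [].
  rewrite /l /r -!exprVn.
  case: (j) => [|i]; first by ring.
  by rewrite -pred_Sn !exprS -natr1; ring.
- rewrite /flat ltxx mulr0 oppr0 addr0.
  have cv : h^-1 *: (flat j (h *: (1 : R) + 0) - flat j 0) @[h --> (0 : R)^'] --> (0 : R).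
    apply/cvgrPdist_le => e e0; near=> h.
    rewrite sub0r normrN {2}/flat ltxx subr0 addr0 /GRing.scale /= mulr1.
    have hN : h != 0 by near: h; exact: nbhs_dnbhs_neq.
    rewrite normrM normfV ler_pdivrMl ?normr_gt0//.
    apply: (le_trans (flat_le j h)).
    rewrite -(real_normK (num_real h)) expr2 mulrCA ler_wpM2l//.
    have f0 : 0 < (j.+2)`!%:R :> R by rewrite ltr0n fact_gt0.
    rewrite mulrC -ler_pdivlMr//; near: h; apply: dnbhs0_le.
    by rewrite divr_gt0.
  by apply: DeriveDef; [apply: cvgP cv|exact: cvg_lim cv].
Unshelve. all: by end_near. Qed.

Lemma smooth_flat j : smooth (flat j).
Proof.
move=> k; elim: k j => [|k IH] j; first exact: is_derive_continuous (is_derive_flat j).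
exists (fun x => - (j%:R * flat j.+1 x) + flat j.+2 x); first exact: is_derive_flat.
apply: CnD; last exact: IH.
rewrite (_ : (fun x => _) = (fun x => (- j%:R) * flat j.+1 x)); last first.
  by apply/funext => x; rewrite mulNr.
by apply: CnM; [exact: smooth_cst|exact: IH].
Qed.

Lemma flat_ge0 j x : 0 <= flat j x.
Proof.
rewrite /flat; case: ifPn => // x0.
by rewrite mulr_ge0 ?expR_ge0// invr_ge0 exprn_ge0// ltW.
Qed.

Definition bump x : R := flat 0 x * flat 0 (1 - x).

Lemma smooth_bump : smooth bump.
Proof.
move=> k; apply: CnM; first exact: smooth_flat.
rewrite (_ : (fun x => _) = (fun x => flat 0 (-1 * x + 1))); last first.
  by apply/funext => x; rewrite mulN1r addrC.
by apply: Cn_affine; exact: smooth_flat.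
Qed.

Lemma bump_ge0 x : 0 <= bump x.
Proof. by rewrite mulr_ge0// flat_ge0. Qed.

Lemma bump_le0 x : x <= 0 -> bump x = 0.
Proof. by move=> x0; rewrite /bump /flat ltNge x0 /= mul0r. Qed.

Lemma bump_ge1 x : 1 <= x -> bump x = 0.
Proof. by move=> x0; rewrite /bump /flat subr_gt0 [x < 1]ltNge x0 /= mulr0. Qed.

Let Ibump : segment_integrable bump.
Proof. exact/continuous_segment_integrable/(@Cn_continuous 0)/smooth_bump. Qed.

Lemma is_derive_prim_cont f x : continuous f ->
  is_derive x (1 : R) (prim f) (f x).
Proof.
move=> cf; apply: is_derive_prim; last exact: cf.
  exact: continuous_segment_integrable.
by move=> y z yz; rewrite primB//; exact: continuous_segment_integrable.
Qed.

Lemma ge0_prim_nondecreasing f : segment_integrable f -> (forall x, 0 <= f x) ->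
  nondecreasing (prim f).
Proof.
move=> If f0 x y xy; rewrite -subr_ge0 primB//.
by apply: Rintegral_ge0 => z _.
Qed.

Lemma prim_cst_on f a x y : segment_integrable f -> x <= y ->
  (forall z, x < z <= y -> f z = a) -> prim f y - prim f x = a * (y - x).
Proof.
move=> If xy fa; rewrite primB// (_ : \int[mu]_(z in _) _ = \int[mu]_(z in `]x, y]) a).
  rewrite Rintegral_cst//= lebesgue_measure_itv /= lte_fin.
  move: xy; rewrite le_eqVlt => /predU1P[->|->]; first by rewrite ltxx subrr.
  by [].
by apply: eq_Rintegral => z; rewrite inE /= in_itv /=; exact: fa.
Qed.

(** If the total mass were zero then the primitive, being nondecreasing, would
    be constant on the unit interval, and its derivative [bump] would vanish at
    the midpoint. *)
Lemma prim_bump1_gt0 : 0 < prim bump 1.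
Proof.
have nd := ge0_prim_nondecreasing Ibump bump_ge0.
rewrite lt_neqAle -[X in X <= _](prim0 bump) nd ?ler01// andbT.
apply/negP => /eqP p1.
have d1 : is_derive (2^-1 : R) (1 : R) (prim bump) (bump 2^-1).
  by apply: is_derive_prim_cont; exact/(@Cn_continuous 0)/smooth_bump.
have d0 : is_derive (2^-1 : R) (1 : R) (prim bump) 0.
  apply: (@near_eq_is_derive _ _ _ (cst (0 : R))).
  near=> x; rewrite /=; apply/esym/eqP; rewrite eq_le; apply/andP; split.
    rewrite [leRHS]p1 nd//; near: x; apply: lt_le_nbhsl.
    by rewrite invf_lt1// ltr1n.
  rewrite -[leLHS](prim0 bump) nd// ltW//; near: x; apply: lt_nbhsr.
  by rewrite invr_gt0.
have : bump (2^-1 : R) = 0 by case: d1 => _ <-; case: d0.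
apply/eqP; rewrite gt_eqF// /bump /flat.
have h : 0 < 2^-1 :> R by rewrite invr_gt0.
have h' : 0 < 1 - 2^-1 :> R by rewrite subr_gt0 invf_lt1// ltr1n.
by rewrite h h' !expr0 invr1 !mul1r mulr_gt0// expR_gt0.
Unshelve. all: by end_near. Qed.

Definition mollifier x : R := (prim bump 1)^-1 * bump x.

Definition step x : R := (prim bump 1)^-1 * prim bump x.

Definition ramp x : R := prim step x.

Lemma smooth_mollifier : smooth mollifier.
Proof. by move=> k; apply: CnM; [exact: smooth_cst|exact: smooth_bump]. Qed.

Lemma is_derive_step x : is_derive x (1 : R) step (mollifier x).
Proof.
apply: is_deriveZ; apply: is_derive_prim_cont.
exact/(@Cn_continuous 0)/smooth_bump.
Qed.

Lemma smooth_step : smooth step.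
Proof. exact: smooth_primitive is_derive_step smooth_mollifier. Qed.

Lemma is_derive_ramp x : is_derive x (1 : R) ramp (step x).
Proof. apply: is_derive_prim_cont; exact/(@Cn_continuous 0)/smooth_step. Qed.

Lemma smooth_ramp : smooth ramp.
Proof. exact: smooth_primitive is_derive_ramp smooth_step. Qed.

Lemma mollifier_ge0 x : 0 <= mollifier x.
Proof. by rewrite mulr_ge0 ?bump_ge0// invr_ge0 ltW// prim_bump1_gt0. Qed.

Lemma mollifier_le0 x : x <= 0 -> mollifier x = 0.
Proof. by move=> x0; rewrite /mollifier bump_le0// mulr0. Qed.

Lemma mollifier_ge1 x : 1 <= x -> mollifier x = 0.
Proof. by move=> x1; rewrite /mollifier bump_ge1// mulr0. Qed.

Lemma step_le0 x : x <= 0 -> step x = 0.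
Proof.
move=> x0; have := @prim_cst_on bump 0 x 0 Ibump x0.
rewrite prim0 sub0r mul0r => h; rewrite /step.
suff : - prim bump x = 0 by move/eqP; rewrite oppr_eq0 => /eqP ->; rewrite mulr0.
by apply: h => z /andP[_ z0]; exact: bump_le0.
Qed.

Lemma step_ge1 x : 1 <= x -> step x = 1.
Proof.
move=> x0; have := @prim_cst_on bump 0 1 x Ibump x0.
rewrite mul0r => h; rewrite /step.
have -> : prim bump x = prim bump 1.
  by apply/eqP; rewrite -subr_eq0 h// => z /andP[/ltW z0 _]; exact: bump_ge1.
by rewrite mulVf// gt_eqF// prim_bump1_gt0.
Qed.

Lemma step_nondecreasing : nondecreasing step.
Proof.
move=> x y xy; rewrite ler_wpM2l ?invr_ge0 ?(ltW prim_bump1_gt0)//.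
exact: ge0_prim_nondecreasing Ibump bump_ge0 _ _ xy.
Qed.

Lemma step_ge0 x : 0 <= step x.
Proof.
have [x0|/ltW x0] := leP x 0; first by rewrite step_le0.
by rewrite -[leLHS](@step_le0 0)// step_nondecreasing.
Qed.

Lemma step_le1 x : step x <= 1.
Proof.
have [x1|/ltW x1] := leP 1 x; first by rewrite step_ge1.
by rewrite -[leRHS](@step_ge1 1)// step_nondecreasing.
Qed.

Let Istep : segment_integrable step.
Proof. exact/continuous_segment_integrable/(@Cn_continuous 0)/smooth_step. Qed.

Lemma ramp_le0 x : x <= 0 -> ramp x = 0.
Proof.
move=> x0; have := @prim_cst_on step 0 x 0 Istep x0.
rewrite prim0 sub0r mul0r => h; apply: oppr_inj; rewrite oppr0; apply: h.
by move=> z /andP[_ z0]; exact: step_le0.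
Qed.

Lemma ramp_ge1 x : 1 <= x -> ramp x = ramp 1 + (x - 1).
Proof.
move=> x1; have := @prim_cst_on step 1 1 x Istep x1.
rewrite mul1r => <-; first by rewrite addrC subrK.
by move=> z /andP[/ltW z1 _]; exact: step_ge1.
Qed.

End smooth.

(** * Products of a time cut-off and a space function *)
Section tensor.
Context {R : realType}.
Notation mu := (@lebesgue_measure R).
Implicit Types (f g df dg : R -> R) (k : nat).

(** Products of functions of one variable are the only space-time test
    functions needed: with a cut-off equal to [1] on [[0, t]], the weak identity
    becomes an identity between distributions in space, at each time. *)
Definition tensor f g (p : R * R) : R := f p.1 * g p.2.

Lemma is_derive_quotient f (d x : R) : is_derive x (1 : R) f d ->
  h^-1 *: (f (h *: (1 : R) + x) - f x) @[h --> (0 : R)^'] --> d.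
Proof. by case=> fx <-; exact: fx. Qed.

Lemma tensor_dt f g df : (forall x, is_derive x (1 : R) f (df x)) ->
  (forall p, derivable (tensor f g) p (1, 0)) /\ dt (tensor f g) = tensor df g.
Proof.
move=> fd.
have h p : h^-1 *: (tensor f g (h *: (1, 0) + p) - tensor f g p)
    @[h --> (0 : R)^'] --> tensor df g p.
  rewrite (_ : (fun h => _) =
      (fun h => (h^-1 *: (f (h *: (1 : R) + p.1) - f p.1)) * g p.2)); last first.
    apply/funext => h; rewrite /tensor /= scaler0 add0r.
    by rewrite /GRing.scale /= -mulrBl mulrA.
  by apply: cvgMl; exact: is_derive_quotient.
split=> [p|]; first by apply: cvgP (h p).
by apply/funext => p; exact: cvg_lim (h p).
Qed.

Lemma tensor_dx f g dg : (forall x, is_derive x (1 : R) g (dg x)) ->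
  (forall p, derivable (tensor f g) p (0, 1)) /\ dx (tensor f g) = tensor f dg.
Proof.
move=> fd.
have h p : h^-1 *: (tensor f g (h *: (0, 1) + p) - tensor f g p)
    @[h --> (0 : R)^'] --> tensor f dg p.
  rewrite (_ : (fun h => _) =
      (fun h => f p.1 * (h^-1 *: (g (h *: (1 : R) + p.2) - g p.2)))); last first.
    apply/funext => h; rewrite /tensor /= scaler0 add0r.
    by rewrite /GRing.scale /= -mulrBr mulrCA.
  by apply: cvgMr; exact: is_derive_quotient.
split=> [p|]; first by apply: cvgP (h p).
by apply/funext => p; exact: cvg_lim (h p).
Qed.

Lemma Ck_tensor k f g : Cn k f -> Cn k g -> Ck k (tensor f g).
Proof.
have cont f' g' : continuous f' -> continuous g' -> continuous (tensor f' g').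
  move=> cf cg p; apply: cvgM.
    by apply: (@continuous_comp _ _ _ fst f'); [exact: cvg_fst|exact: cf].
  by apply: (@continuous_comp _ _ _ snd g'); [exact: cvg_snd|exact: cg].
elim: k f g => [|k IH] f g; first by move=> cf cg; split=> //; exact: cont.
move=> Cf Cg; split; first by apply: cont; [exact: Cn_continuous Cf|exact: Cn_continuous Cg].
have Cf' := CnW Cf; have Cg' := CnW Cg.
move: Cf Cg => [df fd Cf] [dg gd Cg].
have [ht et] := tensor_dt g fd; have [hx ex] := tensor_dx f gd.
by split=> //; rewrite ?et ?ex; exact: IH.
Qed.

Definition cutoff (t1 t2 t : R) : R := 1 - step ((t - t1) / (t2 - t1)).

Lemma cutoff_cst t1 t2 t : t1 < t2 -> t <= t1 -> cutoff t1 t2 t = 1.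
Proof.
move=> t12 tt1; rewrite /cutoff step_le0 ?subr0//.
by rewrite pmulr_lle0 ?invr_gt0 ?subr_gt0// subr_le0.
Qed.

Lemma cutoff0 t1 t2 t : t1 < t2 -> t2 <= t -> cutoff t1 t2 t = 0.
Proof.
move=> t12 tt1; rewrite /cutoff step_ge1 ?subrr//.
by rewrite ler_pdivlMr ?subr_gt0// mul1r lerD2r.
Qed.

Lemma smooth_cutoff t1 t2 : smooth (cutoff t1 t2).
Proof.
rewrite /cutoff => k; apply: CnD; first exact: smooth_cst.
rewrite (_ : (fun x => _) =
  (fun t => (-1) * step ((t2 - t1)^-1 * t + (- t1 / (t2 - t1))))); last first.
  by apply/funext => t; rewrite mulN1r; congr (- step _); ring.
by apply: CnM; [exact: smooth_cst|apply: Cn_affine; exact: smooth_step].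
Qed.

Lemma test_function_tensor (T : \bar R) t1 t2 f L : 0 <= t1 -> t1 < t2 ->
  (t2%:E < T)%E -> smooth f -> (forall x, L < `|x| -> f x = 0) ->
  test_function T (tensor (cutoff t1 t2) f).
Proof.
move=> t10 t12 t2T sf f0.
have sub : closure [set p : R * R | 0 <= p.1 /\ tensor (cutoff t1 t2) f p != 0]
    `<=` `[0, t2] `*` `[- L, L].
  have cl : closed (`[0, t2] `*` `[- L, L] : set (R * R)).
    apply: compact_closed; first exact: norm_hausdorff.
    by apply: compact_setX; exact: segment_compact.
  rewrite [X in _ `<=` X](closure_id _).1//; apply: closure_subset.
  move=> [t x] /= [tge0]; rewrite /tensor /= mulf_eq0 negb_or => /andP[ct fx].
  rewrite !in_itv /= tge0 /=; split.
    by rewrite leNgt; apply: contra ct => /ltW h; rewrite cutoff0.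
  by rewrite -ler_norml leNgt; apply: contra fx => h; rewrite f0.
split.
- by move=> k; apply: Ck_tensor; [exact: smooth_cutoff|exact: sf].
- apply: (@subclosed_compact _ _ (`[0, t2] `*` `[- L, L])) => //.
    exact: closed_closure.
  by apply: compact_setX; exact: segment_compact.
- move=> [t x] /sub [/= + _]; rewrite in_itv /= => /andP[tge0 tt2]; split=> //=.
  by apply: le_lt_trans t2T; rewrite lee_fin.
Qed.

End tensor.

(** * The potential of the difference of two solutions *)
Section representation.
Context {R : realType}.
Notation mu := (@lebesgue_measure R).
Implicit Types (f F G D M N q phi : R -> R) (a b c p x y z e L : R).

Lemma lipschitz_of_primitive G D C : measurable_fun setT D ->
  (forall x, `|D x| <= C) ->
  (forall x y, x <= y -> G y - G x = \int[mu]_(t in `]x, y]) D t) ->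
  forall x y, `|G y - G x| <= C * `|y - x|.
Proof.
move=> mD DC GD x y; wlog xy : x y / x <= y => [hw|].
  have [/hw //|/ltW/hw] := leP x y.
  by rewrite -normrN opprB -[X in _ * X]normrN opprB.
rewrite GD// [X in _ <= _ * X]ger0_norm ?subr_ge0//.
apply: Rintegral_bound => //; exact: measurable_funTS.
Qed.

Lemma lipschitz_continuous G C : (forall x y, `|G y - G x| <= C * `|y - x|) ->
  continuous G.
Proof.
move=> h x; apply/cvgrPdist_le => e e0; near=> y.
rewrite distrC; apply: (le_trans (h x y)).
apply: (@le_trans _ _ ((`|C| + 1) * `|y - x|)).
  by rewrite ler_wpM2r// (le_trans (ler_norm _))// lerDl.
rewrite mulrC -ler_pdivlMr ?ltr_wpDl// distrC.
by near: y; apply: cvgr_dist_le; [exact: cvg_id|rewrite divr_gt0// ltr_wpDl].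
Unshelve. all: by end_near. Qed.

Lemma Rintegral_derive F f a b : (forall x, is_derive x (1 : R) F (f x)) ->
  continuous f -> a <= b -> \int[mu]_(x in `]a, b]) f x = F b - F a.
Proof.
move=> Ff cf ab; rewrite -primB//; last exact: continuous_segment_integrable.
have h x : is_derive x (1 : R) (fun y => prim f y - F y) 0.
  rewrite -(subrr (f x)); apply: is_deriveB; exact: is_derive_prim_cont.
by have := is_derive_0_is_cst a b h; lra.
Qed.

Lemma Rintegral_supp f a b : (forall x, ~~ (a < x <= b) -> f x = 0) ->
  \int[mu]_x f x = \int[mu]_(x in `]a, b]) f x.
Proof.
move=> f0; rewrite [RHS]Rintegral_mkcond; apply: eq_Rintegral => x _.
rewrite patchE; case: ifPn => //; rewrite notin_setE /= in_itv /= => /negP.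
exact: f0.
Qed.

Lemma weight1_ge L x : `|x| <= L -> 1 <= (1 + L ^+ 2) * weight 1 x.
Proof.
move=> xL; rewrite /weight expr1n ler_pdivlMr ?mul1r; last first.
  by rewrite ltr_wpDr ?sqr_ge0.
rewrite lerD2l -(real_normK (num_real x)) lerXn2r ?nnegrE//.
by rewrite (le_trans _ xL).
Qed.

Lemma lipschitz_of_derive f df B : (forall x, is_derive x (1 : R) f (df x)) ->
  (forall x, `|df x| <= B) -> forall x y, `|f y - f x| <= B * `|y - x|.
Proof.
move=> fd dB x y; wlog xy : x y / x <= y => [hw|].
  have [/hw //|/ltW/hw] := leP x y.
  by rewrite -normrN opprB -[X in _ * X]normrN opprB.
have cf : {within `[x, y], continuous f}.
  by apply: continuous_subspaceT; exact: is_derive_continuous fd.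
have [z _ ->] := MVT_segment xy (fun z _ => fd z) cf.
by rewrite normrM ler_wpM2r.
Qed.

Lemma compact_ibp phi dphi D L B : 0 <= L ->
  (forall x, is_derive x (1 : R) phi (dphi x)) -> continuous dphi ->
  (forall x, L < `|x| -> phi x = 0) ->
  (forall x, `|dphi x| <= B) ->
  measurable_fun setT D -> (forall x, D z @[z --> x^'+] --> D x) ->
  (forall x, `|D x| <= 1) ->
  \int[mu]_x (phi x * D x) = \int[mu]_x (- (dphi x * prim D x)).
Proof.
move=> L0 pd cdp p0 dB mD cD D1.
have ID := bounded_segment_integrable mD D1.
have cp := is_derive_continuous pd.
have GD x y : x <= y -> prim D y - prim D x = \int[mu]_(t in `]x, y]) D t by exact: primB.
have GL x y : `|prim D y - prim D x| <= `|y - x|.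
  by have := lipschitz_of_primitive mD D1 GD x y; rewrite mul1r.
have G0 x : `|prim D x| <= `|x|.
  by have := GL 0 x; rewrite prim0 !subr0.
have B0 : 0 <= B by rewrite (le_trans _ (dB 0)).
have pL := lipschitz_of_derive pd dB.
have pB x : `|phi x| <= B * (2 * L + 1).
  have [xL|xL] := leP `|x| L; last by rewrite p0// normr0 mulr_ge0//; lra.
  have := pL (L + 1) x; rewrite (p0 (L + 1)) ?subr0; last by rewrite ger0_norm; lra.
  move=> /le_trans; apply; rewrite ler_wpM2l// (le_trans (ler_normB _ _))//.
  by rewrite [`|L + 1|]ger0_norm; lra.
set K := (L + 1).
have K0 : 0 <= K by rewrite /K; lra.
have outer x h : `|h| <= 1 -> K < `|x| -> phi (x + h) = 0.
  move=> h1 Kx; apply: p0; rewrite /K in Kx.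
  have := ler_normB (x + h) h; rewrite addrK; lra.
have outer0 x : K < `|x| -> phi x = 0.
  by move=> Kx; apply: p0; rewrite /K in Kx; lra.
have w0 x : 0 <= weight 1 x :> R by rewrite ltW// weight_gt0.
have inner (x a b : R) : 0 <= b -> `|x| <= K -> a <= b -> a <= b * ((1 + K ^+ 2) * weight 1 x).
  move=> b0 xK /le_trans; apply.
  by rewrite -[leLHS]mulr1 ler_wpM2l// weight1_ge.
pose C0 := B * (2 * L + 1) * (1 + K).
have C00 : 0 <= C0 by rewrite /C0 mulr_ge0// ?addr_ge0// mulr_ge0//; lra.
have C0w x : 0 <= C0 * (1 + K ^+ 2) * weight 1 x.
  by rewrite mulr_ge0// mulr_ge0// addr_ge0// sqr_ge0.
apply: (@weighted_ibp _ _ _ _ _ (C0 * (1 + K ^+ 2))) => //.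
- exact: continuous_measurable_fun.
- exact: continuous_measurable_fun.
- apply: continuous_measurable_fun; apply: (@lipschitz_continuous _ 1) => x y.
  by rewrite mul1r.
- move=> x; have [xK|xK] := leP `|x| K; last first.
    by rewrite outer0// mul0r normr0.
  rewrite -mulrA; apply: inner => //; rewrite normrM /C0 ler_pM//.
  by rewrite (le_trans (G0 x))//; lra.
- move=> x h h1; have [xK|xK] := leP `|x| K; last first.
    by rewrite outer0// mul0r normr0 mulr_ge0.
  rewrite normrM mulrC; apply: ler_pM => //.
    by have := GL x (x + h); rewrite [x + h - x]addrC addKr.
  rewrite -mulrA; apply: inner => //; rewrite /C0.
  by rewrite (le_trans (pB x))// ler_peMr ?mulr_ge0//; lra.
- move=> x h h1; have [xK|xK] := leP `|x| K; last first.
    by rewrite outer// outer0// subrr mul0r normr0 mulr_ge0.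
  rewrite normrM.
  apply: (@le_trans _ _ (`|h| * (B * K))).
    rewrite mulrA; apply: ler_pM => //; last by rewrite (le_trans (G0 x)).
    by have := pL x (x + h); rewrite [x + h - x]addrC addKr mulrC.
  rewrite ler_wpM2l// -mulrA; apply: inner => //; rewrite /C0 -mulrA ler_wpM2l//.
  by rewrite (@le_trans _ _ (1 * (1 + K)))// ?ler_wpM2r//; lra.
- exact: aeW.
Qed.


(** Up to a translation of size [e], the smoothing at scale [e] of the hinge
    [z |-> max (0, z - p)]; the smoothing acts on the right of [p] only, where
    the functions under consideration are right-continuous. *)
Definition hinge e p z : R := e * ramp (e^-1 * z + - (p / e)).
Definition hinge1 e p z : R := step (e^-1 * z + - (p / e)).
Definition hinge2 e p z : R := e^-1 * mollifier (e^-1 * z + - (p / e)).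

Lemma hingeE e p z : e^-1 * z + - (p / e) = (z - p) / e.
Proof. by rewrite mulrC -mulrBl. Qed.

Lemma is_derive_hinge e p z : 0 < e ->
  is_derive z (1 : R) (hinge e p) (hinge1 e p z).
Proof.
move=> e0; rewrite -[hinge1 e p z](mulVKf (lt0r_neq0 e0)).
have := is_derive_affine (is_derive_ramp (e^-1 * z + - (p / e))).
by move=> /(is_deriveZ e); rewrite /GRing.scale /= mulrA mulfV ?mul1r ?gt_eqF.
Qed.

Lemma is_derive_hinge1 e p z : is_derive z (1 : R) (hinge1 e p) (hinge2 e p z).
Proof. exact: is_derive_affine (is_derive_step _). Qed.

Lemma smooth_hinge e p : smooth (hinge e p).
Proof.
by move=> k; apply: CnM; [exact: smooth_cst|apply: Cn_affine; exact: smooth_ramp].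
Qed.

Lemma smooth_hinge1 e p : smooth (hinge1 e p).
Proof. by move=> k; apply: Cn_affine; exact: smooth_step. Qed.

Lemma smooth_hinge2 e p : smooth (hinge2 e p).
Proof.
by move=> k; apply: CnM; [exact: smooth_cst|apply: Cn_affine; exact: smooth_mollifier].
Qed.

Section hinge_values.
Variables (e p z : R).
Hypothesis e0 : 0 < e.

Lemma hinge_le : z <= p ->
  [/\ hinge e p z = 0, hinge1 e p z = 0 & hinge2 e p z = 0].
Proof.
move=> zp; have h : e^-1 * z + - (p / e) <= 0.
  by rewrite hingeE pmulr_lle0 ?invr_gt0// subr_le0.
by rewrite /hinge /hinge1 /hinge2 ramp_le0// step_le0// mollifier_le0// !mulr0.
Qed.

Lemma hinge_ge : p + e <= z ->
  [/\ hinge e p z = e * (ramp 1 - 1) + (z - p), hinge1 e p z = 1 & hinge2 e p z = 0].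
Proof.
move=> zp; have h : 1 <= e^-1 * z + - (p / e).
  by rewrite hingeE ler_pdivlMr// mul1r lerBrDl.
rewrite /hinge /hinge1 /hinge2 ramp_ge1// step_ge1// mollifier_ge1// mulr0; split=> //.
by rewrite hingeE; field; rewrite gt_eqF.
Qed.

End hinge_values.

Lemma hinge1_ge0 e p z : 0 <= hinge1 e p z. Proof. exact: step_ge0. Qed.
Lemma hinge1_le1 e p z : hinge1 e p z <= 1. Proof. exact: step_le1. Qed.
Lemma hinge2_ge0 e p z : 0 < e -> 0 <= hinge2 e p z.
Proof. by move=> e0; rewrite mulr_ge0 ?mollifier_ge0// invr_ge0 ltW. Qed.

Let h n : R := n.+1%:R^-1.
Let h0 n : 0 < h n. Proof. by rewrite invr_gt0 ltr0n. Qed.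
Let hcvg : h n @[n --> \oo] --> (0 : R). Proof. exact: cvg_harmonic. Qed.

Lemma hinge1_cvg q p L : segment_integrable q -> p <= L ->
  \int[mu]_(z in `]p, L]) (hinge1 (h n) p z * q z) @[n --> \oo] -->
  \int[mu]_(z in `]p, L]) q z.
Proof.
move=> Iq pL.
have mq : measurable_fun `]p, L] q.
  by have /integrableP[/measurable_EFinP] := Iq p L.
apply: (@Rintegral_dominated_cvg _ _ _ mu _ _ _ (fun x => `|q x|)) => //.
- move=> n; apply: measurable_funM => //; apply: measurable_funTS.
  apply: continuous_measurable_fun; exact: (smooth_hinge1 _ _ 0).
- apply: aeW => z; rewrite /= in_itv /= => /andP[pz _].
  rewrite -[X in _ --> X]mul1r; apply: cvgMl.
  apply: cvg_near_cst; near=> n.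
  have [] // := @hinge_ge (h n) p z (h0 n).
  rewrite -lerBrDl; near: n.
  by have /cvgr_le := hcvg; apply; rewrite subr_gt0.
- exact: (integrable_norm (Iq p L)).
- move=> n z _; rewrite normrM ler_piMl// ger0_norm ?hinge1_ge0//.
  exact: hinge1_le1.
Unshelve. all: by end_near. Qed.

(** The second derivatives of the smoothed hinges form an approximation of the
    unit mass at [p] carried by the right of [p]. *)
Lemma hinge2_cvg M p L C : measurable_fun setT M -> (forall x, `|M x| <= C) ->
  (forall x, M z @[z --> x^'+] --> M x) -> p < L ->
  \int[mu]_(z in `]p, L]) (hinge2 (h n) p z * M z) @[n --> \oo] --> M p.
Proof.
move=> mM MC cM pL.
apply/cvgrPdist_le => e e0; near=> n.
have pnL : p + h n <= L.
  rewrite -lerBrDl; near: n.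
  by have /cvgr_le := hcvg; apply; rewrite subr_gt0.
have ck : continuous (hinge2 (h n) p) by exact: (smooth_hinge2 _ _ 0).
have Ik : segment_integrable (hinge2 (h n) p) by exact: continuous_segment_integrable.
have IM : segment_integrable M by exact: bounded_segment_integrable mM MC.
have IMp : segment_integrable (fun z => M z - M p).
  apply: (@bounded_segment_integrable _ _ (C + C)); first exact: measurable_funB.
  by move=> z; rewrite (le_trans (ler_normB _ _))// lerD.
have Icst : segment_integrable (cst (M p)).
  by apply: (@bounded_segment_integrable _ _ `|M p|).
have k1 : \int[mu]_(z in `]p, L]) hinge2 (h n) p z = 1.
  rewrite (Rintegral_derive (is_derive_hinge1 (h n) p) ck (ltW pL)).
  have [_ -> _] := hinge_ge (h0 n) pnL.
  have [_ -> _] := @hinge_le (h n) p p (h0 n) (lexx _).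
  by rewrite subr0.
have -> : M p - \int[mu]_(z in `]p, L]) (hinge2 (h n) p z * M z) =
    - \int[mu]_(z in `]p, L]) (hinge2 (h n) p z * (M z - M p)).
  under [in RHS]eq_Rintegral do rewrite mulrBr.
  rewrite (RintegralB _ (segment_integrableM ck IM _ _)
    (segment_integrableM ck Icst _ _))//.
  by rewrite RintegralZr// k1 mul1r opprB.
rewrite normrN.
have Id := segment_integrableM ck IMp.
rewrite (le_trans (le_normr_Rintegral _ (Id _ _)))//.
rewrite -[leRHS]mulr1 -k1 -RintegralZl//.
apply: le_Rintegral => //.
- exact: (integrable_norm (Id _ _)).
- have mpL : measurable (`]p, L]%classic : set (measurableTypeR R)) by [].
  exact: (integrableZl mpL e (Ik p L)).
move=> z; rewrite /= in_itv /= => /andP[pz zL].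
rewrite normrM (ger0_norm (hinge2_ge0 _ _ (h0 n))) mulrC.
have [zn|zn] := leP (p + h n) z.
  by have [_ _ ->] := hinge_ge (h0 n) zn; rewrite !mulr0.
rewrite ler_wpM2r ?hinge2_ge0//.
move: z pz zL zn; near: n.
have /cvgrPdist_le /(_ _ e0) [r /= r0 hr] := cM p.
near=> n => z pz zL zn; rewrite distrC; apply: hr => //=.
rewrite distrC gtr0_norm ?subr_gt0// ltrBlDl (lt_trans zn)// ltrD2l.
near: n; by have /cvgr_lt := hcvg; apply.
Unshelve. all: by end_near. Qed.

(** The hypothesis says that [D = M'' - N'] in the sense of distributions, that
    is, that [K = M - prim (prim D + N)] has zero second derivative. Three hinges
    at [0], [1] and [x], with coefficients [x - 1], [- x] and [1], combine into a
    compactly supported function; in the limit where the smoothing disappears,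
    they give [(x - 1) K 0 - x K 1 + K x = 0]. So [K] is affine, and its slope [c]
    is the constant to be added to the primitive of [D]. *)
Lemma potential_exists D M N CM CN :
  measurable_fun setT D -> measurable_fun setT M -> measurable_fun setT N ->
  (forall x, D z @[z --> x^'+] --> D x) ->
  (forall x, M z @[z --> x^'+] --> M x) ->
  (forall x, `|D x| <= 1) -> (forall x, `|M x| <= CM) ->
  (forall x, `|N x| <= CN) ->
  (forall phi dphi ddphi L, smooth phi ->
     (forall x, is_derive x (1 : R) phi (dphi x)) ->
     (forall x, is_derive x (1 : R) dphi (ddphi x)) ->
     (forall x, L < `|x| -> [/\ phi x = 0, dphi x = 0 & ddphi x = 0]) ->
     continuous ddphi ->
     \int[mu]_x (phi x * D x) = \int[mu]_x (ddphi x * M x + dphi x * N x)) ->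
  exists c, forall x y, x <= y ->
    M y - M x = \int[mu]_(z in `]x, y]) (c + prim D z + N z).
Proof.
move=> mD mM mN cD cM D1 MC NC weak.
have ID := bounded_segment_integrable mD D1.
have GD x y : x <= y -> prim D y - prim D x = \int[mu]_(t in `]x, y]) D t by exact: primB.
have cG : continuous (prim D).
  by apply: (@lipschitz_continuous _ 1) => x y; exact: lipschitz_of_primitive mD D1 GD x y.
have mG : measurable_fun setT (prim D) by exact: continuous_measurable_fun.
pose q z := prim D z + N z.
have Iq : segment_integrable q.
  apply: segment_integrableD; first exact: continuous_segment_integrable.
  exact: bounded_segment_integrable mN NC.
have mq : measurable_fun setT q by exact: measurable_funD.
have key x : (x - 1) * M 0 - x * (M 1 - prim q 1) + (M x - prim q x) = 0.
  pose L := `|x| + 3.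
  have xL : x + 1 < L by rewrite /L; have := ler_norm x; lra.
  have xL' : - L < x by rewrite /L; have := ler_norm (- x); rewrite normrN; lra.
  have L3 : 3 <= L by rewrite /L lerDr.
  pose I n p := \int[mu]_(z in `]p, L]) (hinge2 (h n) p z * M z) +
     \int[mu]_(z in `]p, L]) (hinge1 (h n) p z * q z).
  have Icv p : p < L -> I n p @[n --> \oo] --> M p + (prim q L - prim q p).
    move=> pL; apply: cvgD; first exact: hinge2_cvg mM MC cM pL.
    by rewrite primB//; [exact: hinge1_cvg (ltW pL)|exact: ltW].
  have I0 n : (x - 1) * I n 0 - x * I n 1 + I n x = 0.
    pose e := h n; have e0 : 0 < e := h0 n.
    have e1 : e <= 1 by rewrite /e invf_le1 ?ltr0n// ler1n.
    pose comb (f : R -> R -> R) z := (x - 1) * f 0 z + (- x) * f 1 z + f x z.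
    have scomb (f : R -> R -> R) : (forall p, smooth (f p)) -> smooth (comb f).
      move=> sf k; apply: CnD; last exact: sf.
      by apply: CnD; (apply: CnM; [exact: smooth_cst|exact: sf]).
    have dcomb (f df : R -> R -> R) : (forall p z, is_derive z (1 : R) (f p) (df p z)) ->
        forall z, is_derive z (1 : R) (comb f) (comb df z).
      move=> fd z; have d0 := is_deriveZ (x - 1) (fd 0 z).
      have d1 := is_deriveZ (- x) (fd 1 z).
      exact: is_deriveD (is_deriveD d0 d1) (fd x z).
    have c2 : continuous (comb (hinge2 e)) by exact: (scomb _ (smooth_hinge2 e) 0).
    have c1 : continuous (comb (hinge1 e)) by exact: (scomb _ (smooth_hinge1 e) 0).
    have outL z : z <= - L -> [/\ comb (hinge e) z = 0, comb (hinge1 e) z = 0 & comb (hinge2 e) z = 0].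
      move=> zL; rewrite /comb.
      have [|-> -> ->] := @hinge_le e 0 z e0; first by lra.
      have [|-> -> ->] := @hinge_le e 1 z e0; first by lra.
      have [|-> -> ->] := @hinge_le e x z e0; first by lra.
      by split; ring.
    have outR z : L < z -> [/\ comb (hinge e) z = 0, comb (hinge1 e) z = 0 & comb (hinge2 e) z = 0].
      move=> zL; rewrite /comb.
      have [|-> -> ->] := @hinge_ge e 0 z e0; first by lra.
      have [|-> -> ->] := @hinge_ge e 1 z e0; first by lra.
      have [|-> -> ->] := @hinge_ge e x z e0; first by lra.
      by split; ring.
    have out z : L < `|z| -> [/\ comb (hinge e) z = 0, comb (hinge1 e) z = 0 & comb (hinge2 e) z = 0].
      by rewrite ltr_normr => /orP[/outR//|zL]; apply: outL; lra.
    have w := weak _ _ _ L (scomb _ (smooth_hinge e))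
      (dcomb _ _ (fun p z => is_derive_hinge p z e0))
      (dcomb _ _ (fun p z => is_derive_hinge1 e p z)) out c2.
    have L0 : 0 <= L by lra.
    have b1 z : `|comb (hinge1 e) z| <= `|x - 1| + `|x| + 1.
      have hb p : `|hinge1 e p z| <= 1 by rewrite ger0_norm ?hinge1_ge0 ?hinge1_le1.
      rewrite (le_trans (ler_normD _ _))// lerD// (le_trans (ler_normD _ _))//.
      by rewrite (normrM (x - 1)) (normrM (- x)) normrN; apply: lerD; apply: ler_piMr.
    have := compact_ibp L0 (dcomb _ _ (fun p z => is_derive_hinge p z e0)) c1
      (fun z Lz => let: And3 h _ _ := out z Lz in h) b1 mD cD D1.
    rewrite w.
    have supp f : (forall z, comb (hinge1 e) z = 0 -> comb (hinge2 e) z = 0 -> f z = 0) ->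
        \int[mu]_z f z = \int[mu]_(z in `]- L, L]) f z.
      move=> f0; apply: Rintegral_supp => z.
      rewrite negb_and -leNgt -ltNge => /orP[/outL|/outR] [_ ? ?]; exact: f0.
    rewrite supp; last by move=> z -> ->; rewrite !mul0r addr0.
    rewrite supp; last by move=> z -> _; rewrite mul0r oppr0.
    move=> ibp.
    have IM : segment_integrable M by exact: bounded_segment_integrable mM MC.
    have IN : segment_integrable N by exact: bounded_segment_integrable mN NC.
    have IG : segment_integrable (prim D) by exact: continuous_segment_integrable.
    have tot : \int[mu]_(z in `]- L, L])
       (comb (hinge2 e) z * M z + comb (hinge1 e) z * q z) = 0.
      have I1 : segment_integrable (fun z => comb (hinge2 e) z * M z + comb (hinge1 e) z * N z).
        by apply: segment_integrableD; exact: segment_integrableM.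
      have I2 : segment_integrable (fun z => - (comb (hinge1 e) z * prim D z)).
        apply: continuous_segment_integrable => z.
        by apply: cvgN; apply: cvgM; [exact: c1|exact: cG].
      under eq_Rintegral => z _.
        rewrite (_ : _ + _ = (comb (hinge2 e) z * M z + comb (hinge1 e) z * N z)
          - (- (comb (hinge1 e) z * prim D z))); last by rewrite opprK /q; ring.
        over.
      by rewrite (RintegralB _ (I1 _ _) (I2 _ _))// ibp subrr.
    pose T p z := hinge2 e p z * M z + hinge1 e p z * q z.
    have IT p : segment_integrable (T p).
      apply: segment_integrableD; apply: segment_integrableM => //.
        exact: (smooth_hinge2 _ _ 0).
      exact: (smooth_hinge1 _ _ 0).
    have IE p : - L <= p -> p <= L -> I n p = \int[mu]_(z in `]- L, L]) T p z.
      move=> Lp pL; rewrite (Rintegral_chasles (IT p) Lp pL).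
      rewrite (_ : \int[mu]_(z in `]- L, p]) T p z = 0); last first.
        rewrite -[RHS](mul0r (fine (mu `]- L, p]))) -Rintegral_cst//.
        apply: eq_Rintegral => z; rewrite inE /= in_itv /= => /andP[_ zp].
        by rewrite /T; have [_ -> ->] := hinge_le e0 zp; rewrite !mul0r addr0.
      rewrite add0r /T RintegralD//.
        apply: segment_integrableM => //; exact: (smooth_hinge2 _ _ 0).
      apply: segment_integrableM => //; exact: (smooth_hinge1 _ _ 0).
    (* the three hinges share the interval of integration, so they can be summed *)
    rewrite !IE; [|lra..].
    have IZ c p : segment_integrable (fun z => c * T p z).
      by apply: segment_integrableM => // z; exact: cvg_cst.
    rewrite -[RHS]tot.
    under [RHS]eq_Rintegral => z _.
      rewrite (_ : _ + _ = ((x - 1) * T 0 z + (- x) * T 1 z) + T x z); last first.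
        by rewrite /comb /T; ring.
      over.
    rewrite (RintegralD _ (segment_integrableD (IZ _ _) (IZ _ _) _ _) (IT _ _ _))//.
    rewrite (RintegralD _ (IZ _ _ _ _) (IZ _ _ _ _))//.
    rewrite (RintegralZl _ _ (IT _ _ _))// (RintegralZl _ _ (IT _ _ _))//.
    by rewrite mulNr.
  have : (x - 1) * I n 0 - x * I n 1 + I n x @[n --> \oo] -->
      (x - 1) * (M 0 + (prim q L - prim q 0)) - x * (M 1 + (prim q L - prim q 1))
      + (M x + (prim q L - prim q x)).
    apply: cvgD; last by apply: Icv; lra.
    by apply: cvgB; apply: cvgMr; apply: Icv; lra.
  rewrite (funext I0) => cv.
  have e := cvg_unique (@Rhausdorff R) cv (@cvg_cst _ (0 : R) _ _ _).
  by rewrite -[RHS]e prim0; ring.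
exists (M 1 - prim q 1 - M 0) => x y xy.
set c := (M 1 - prim q 1 - M 0).
have Ic : segment_integrable (cst c).
  by apply: (@bounded_segment_integrable _ _ `|c|).
have -> : \int[mu]_(z in `]x, y]) (c + prim D z + N z) =
    \int[mu]_(z in `]x, y]) (cst c z + q z).
  by apply: eq_Rintegral => z _; rewrite /= /q; ring.
rewrite (RintegralD _ (Ic _ _) (Iq _ _))//.
rewrite Rintegral_cst//= -primB// lebesgue_measure_itv /= lte_fin.
have -> : c * fine (if x < y then (y%:E - x%:E)%E else 0%E) = c * (y - x).
  move: xy; rewrite le_eqVlt => /predU1P[->|->]; first by rewrite ltxx subrr.
  by [].
have := key x; have := key y; rewrite /c; lra.
Qed.

End representation.

(** * A comparison lemma and the role of strict monotonicity *)
Section real_lemmas.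
Context {R : realType}.
Implicit Types (s t u v : R).

(** The first condition forbids upward jumps, so the first time [tau] at which
    [E] passes above the exponential [y] can be analysed: there [E tau = y tau], and the growth rate of [E] at [tau],
    read off from the left by the second condition, is smaller than that of
    [y]. *)
Lemma one_sided_gronwall (E : R -> R) (t0 C K : R) : 0 <= t0 -> 0 <= K ->
  0 <= E 0 ->
  (forall s t, 0 <= s -> s <= t -> t <= t0 -> E t - E s <= C * (t - s)) ->
  (forall t eta r, 0 < t -> t <= t0 -> 0 < eta -> 0 <= r -> r < t ->
     exists s, [/\ r < s, s < t & E t - E s <= (K * E t + eta) * (t - s)]) ->
  E t0 <= (E 0 + 1) * expR ((K + 1) * t0).
Proof.
move=> t00 K0 E0 H1 H2; rewrite leNgt; apply/negP => bad.
pose y t := (E 0 + 1) * expR ((K + 1) * t).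
have K1 : 0 < K + 1 by rewrite ltr_wpDl.
have E1 : 0 < E 0 + 1 by rewrite ltr_wpDl.
have y0 t : 0 < y t by rewrite mulr_gt0// expR_gt0.
have ymono s t : s <= t -> y s <= y t.
  by move=> st; rewrite ler_pM2l// ler_expR ler_pM2l.
pose C' := `|C| + 1.
have C'0 : 0 < C' by rewrite ltr_wpDl.
have H1' s t : 0 <= s -> s <= t -> t <= t0 -> E t - E s <= C' * (t - s).
  move=> h1 h2 h3; apply: (le_trans (H1 s t h1 h2 h3)).
  by rewrite ler_wpM2r ?subr_ge0// /C' (le_trans (ler_norm C))// lerDl.
pose S := [set t | [/\ 0 <= t, t <= t0 & y t < E t]].
have St0 : S t0 by split.
have lbS : lbound S 0 by move=> t [].
have iS : has_inf S by split; [exists t0|exists 0].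
pose tau := inf S.
have tau0 : 0 <= tau by apply: lb_le_inf => //; exists t0.
have taut0 : tau <= t0 by apply: ge_inf => //; exists 0.
have yE : y tau <= E tau.
  rewrite leNgt; apply/negP => h.
  have e0 : 0 < (y tau - E tau) / C' by rewrite divr_gt0// subr_gt0.
  have [t [t1 t2 yt] tt] := inf_adherent e0 iS.
  have taut : tau <= t by apply: ge_inf; [exists 0|split].
  have := H1' tau t tau0 taut t2; have := ymono _ _ taut.
  have : C' * (t - tau) < y tau - E tau.
    by rewrite mulrC -ltr_pdivlMr// ltrBlDl.
  lra.
have taugt0 : 0 < tau.
  rewrite lt_neqAle tau0 andbT; apply/negP => /eqP e.
  by move: yE; rewrite -e /y mulr0 expR0 mulr1; lra.
have Ey s : 0 <= s -> s < tau -> E s <= y s.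
  move=> s0 st; rewrite leNgt; apply/negP => h.
  have : tau <= s by apply: ge_inf; [exists 0|split=> //; lra].
  lra.
have Ey' : E tau <= y tau.
  rewrite leNgt; apply/negP => h.
  pose s := Num.max 0 (tau - (E tau - y tau) / C').
  have e0 : 0 < (E tau - y tau) / C' by rewrite divr_gt0// subr_gt0.
  have s0 : 0 <= s by rewrite /s le_max lexx.
  have st : s < tau by rewrite /s gt_max taugt0 ltrBlDr ltrDl.
  have hs : tau - s <= (E tau - y tau) / C'.
    by rewrite lerBlDr -lerBlDl /s le_max lexx orbT.
  have := H1' s tau s0 (ltW st) taut0.
  have := ymono _ _ (ltW st); have := Ey s s0 st.
  have : C' * (tau - s) <= E tau - y tau by rewrite mulrC -ler_pdivlMr.
  have : y s < y tau by rewrite /y ltr_pM2l// ltr_expR ltr_pM2l.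
  lra.
have EY : E tau = y tau by apply/eqP; rewrite eq_le Ey' yE.
(* at distance less than d from tau, the convexity defect of y is less than
   the gap between the rates K + 1 and K + 1 / 2 *)
pose d := (2 * (K + 1) ^+ 2)^-1.
have d0 : 0 < d by rewrite invr_gt0 mulr_gt0// exprn_gt0.
have r0 : 0 <= Num.max 0 (tau - d) by rewrite le_max lexx.
have rt : Num.max 0 (tau - d) < tau by rewrite gt_max taugt0 ltrBlDr ltrDl.
have Y0 := y0 tau.
have Y20 : 0 < y tau / 2 by rewrite divr_gt0.
have [s [rs st hs]] := H2 tau _ _ taugt0 taut0 Y20 r0 rt.
move: rs; rewrite gt_max => /andP[s0 sd].
have Es := Ey s (ltW s0) st; rewrite EY in hs.
pose k := K + 1; rewrite -/k in K1.
have yk : y s * (1 + k * (tau - s)) <= y tau.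
  have -> : y tau = y s * expR (k * (tau - s)).
    by rewrite /y -/k -mulrA -expRD; congr (_ * expR _); ring.
  by rewrite ler_pM2l// expR_ge1Dx.
have kp : 0 < 1 + k * (tau - s) by rewrite ltr_wpDr// mulr_ge0 ?(ltW K1)// subr_ge0 ltW.
have zY : y tau * (1 - (k - 2^-1) * (tau - s)) <= y s by rewrite /k; lra.
have : y tau * ((1 - (k - 2^-1) * (tau - s)) * (1 + k * (tau - s))) <= y tau * 1.
  rewrite mulr1 mulrA; apply: le_trans yk.
  by rewrite ler_pM2r.
rewrite ler_pM2l// => hk.
have kd : k ^+ 2 * (tau - s) < 2^-1.
  apply: (@lt_le_trans _ _ (k ^+ 2 * d)).
    by rewrite ltr_pM2l ?exprn_gt0//; lra.
  by rewrite /d -/k invfM mulrCA divff ?mulr1// gt_eqF// exprn_gt0.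
have p0 : 0 < tau - s by rewrite subr_gt0.
have k2 : 0 < k * (tau - s) by rewrite mulr_gt0.
have : (tau - s) * (2^-1 - k * (k - 2^-1) * (tau - s)) <= (tau - s) * 0.
  rewrite mulr0; move: hk; set p := tau - s; lra.
rewrite ler_pM2l//; move: kd k2; rewrite expr2; set p := tau - s; lra.
Qed.

(** This is where strict monotonicity of [A] enters. When [u] and [v] are close,
    the Lipschitz bound on [B] suffices; otherwise [A u - A v] is bounded away
    from zero, because [v |-> A (v + d) - A v] attains a positive minimum. *)
Lemma convection_le_diffusion (A B : R -> R) (LA LB : R) :
  (forall u v, `|A u - A v| <= LA * `|u - v|) ->
  (forall u v, `|B u - B v| <= LB * `|u - v|) ->
  {in `[0, 1] &, {homo A : u v / u < v}} ->
  forall delta, 0 < delta -> exists2 lam, 0 <= lam &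
    forall u v, 0 <= u <= 1 -> 0 <= v <= 1 ->
    `|B u - B v| <= delta + lam * ((u - v) * (A u - A v)).
Proof.
move=> AL BL Ainc delta d0.
have LB0 : 0 <= LB by have := BL 1 0; rewrite subr0 normr1 mulr1; apply: le_trans.
have Amono u v : 0 <= u <= 1 -> 0 <= v <= 1 -> u <= v -> A u <= A v.
  move=> u01 v01; rewrite le_eqVlt => /predU1P[->//|uv].
  by apply/ltW/Ainc; rewrite ?in_itv.
have prod0 u v : 0 <= u <= 1 -> 0 <= v <= 1 -> 0 <= (u - v) * (A u - A v).
  move=> u01 v01; have [uv|/ltW uv] := leP u v.
    by rewrite -mulrNN !opprB mulr_ge0 ?subr_ge0// Amono.
  by rewrite mulr_ge0 ?subr_ge0// Amono.
pose d := delta / (LB + 1).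
have LB1 : 0 < LB + 1 by rewrite ltr_wpDl.
have dd : 0 < d by rewrite divr_gt0.
have small u v : `|u - v| <= d -> `|B u - B v| <= delta.
  move=> uv; apply: (le_trans (BL u v)).
  apply: (@le_trans _ _ ((LB + 1) * d)); first by apply: ler_pM => //; rewrite lerDl.
  by rewrite mulrC divfK// gt_eqF.
have [d1|d1] := leP 1 d.
  exists 0 => // u v /andP[u0 u1] /andP[v0 v1]; rewrite mul0r addr0; apply: small.
  by apply: le_trans d1; rewrite ler_norml; apply/andP; split; lra.
have cA : continuous A by apply: (@lipschitz_continuous _ _ LA) => x y; exact: AL.
have [||c + hc] := @EVT_min R (fun v => A (v + d) - A v) 0 (1 - d).
- by lra.
- apply: continuous_subspaceT => x; apply: cvgB; last exact: cA.
  apply: (@continuous_comp _ _ _ (fun x => x + d) A); last exact: cA.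
  by apply: cvgD; [exact: cvg_id|exact: cvg_cst].
rewrite in_itv /= => /andP[c0 c1].
set al := A (c + d) - A c in hc.
have al0 : 0 < al.
  by rewrite subr_gt0; apply: Ainc; rewrite ?in_itv /= ?ltrDl//; apply/andP; split; lra.
have big u v : 0 <= u <= 1 -> 0 <= v <= 1 -> v + d < u -> d * al <= (u - v) * (A u - A v).
  move=> u01 v01 uv; apply: ler_pM; rewrite ?(ltW dd) ?(ltW al0)//; first by lra.
  move: (u01) (v01) => /andP[u0 u1] /andP[v0 v1].
  have v1d : v \in `[0, 1 - d] by rewrite in_itv /=; apply/andP; split; lra.
  apply: (le_trans (hc v v1d)); rewrite lerD2r Amono//; last exact: ltW.
  by apply/andP; split; lra.
exists (LB / (d * al)); first by rewrite divr_ge0// mulr_ge0// ltW.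
move=> u v u01 v01; have p0 := prod0 u v u01 v01.
have [uv|uv] := leP `|u - v| d.
  rewrite (le_trans (small u v uv))// lerDl mulr_ge0//.
  by rewrite divr_ge0// mulr_ge0// ltW.
have pd : d * al <= (u - v) * (A u - A v).
  move: uv; rewrite ltr_normr => /orP[uv|uv]; first by apply: big => //; lra.
  have -> : (u - v) * (A u - A v) = (v - u) * (A v - A u) by ring.
  by apply: big => //; lra.
have : LB <= LB / (d * al) * ((u - v) * (A u - A v)).
  apply: (@le_trans _ _ (LB / (d * al) * (d * al))).
    by rewrite divfK// gt_eqF// mulr_gt0.
  by rewrite ler_wpM2l// divr_ge0// mulr_ge0// ltW.
have : `|B u - B v| <= LB.
  apply: (le_trans (BL u v)); rewrite ler_piMr// ler_norml.
  by move: u01 v01 => /andP[? ?] /andP[? ?]; apply/andP; split; lra.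
lra.
Qed.

End real_lemmas.

(** * Exponential energies *)
Section energy.
Context {R : realType}.
Notation mu := (@lebesgue_measure R).
Implicit Types (c x y h lam : R).

Definition dweight c x : R := - (2 * x * weight c x ^+ 2).

Lemma is_derive_weight c x : 1 <= c -> is_derive x (1 : R) (weight c) (dweight c x).
Proof.
move=> c1; have d0 : is_derive x (1 : R) (fun y : R => c ^+ 2 + y ^+ 2) (2 * x).
  have := is_deriveD (is_derive_cst (c ^+ 2) x 1) (is_deriveX 2 (is_derive_id x (1 : R))).
  by rewrite add0r /GRing.scale /= expr1 mulr1.
have := @is_deriveV _ (fun y : R => c ^+ 2 + y ^+ 2) x _ 1 (lt0r_neq0 (weight_den_gt0 x c1)) d0.
by rewrite /dweight /weight /GRing.scale /= exprVn mulNr mulrC.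
Qed.

Lemma dweight_le c x : 1 <= c -> `|dweight c x| <= c^-1 * weight c x.
Proof.
move=> c1; have w0 := weight_gt0 x c1; have c0 : 0 < c by lra.
rewrite normrN expr2 mulrA normrM (gtr0_norm w0) ler_pM2r//.
rewrite normrM (gtr0_norm w0) ler_pdivrMr ?weight_den_gt0// normrM.
rewrite (ger0_norm (ler0n _ 2)) ler_pdivlMl//.
have := sqr_ge0 (c - `|x|); have := real_normK (num_real x); nra.
Qed.

Lemma weight_shift c x h : 1 <= c -> `|h| <= 1 ->
  `|weight c (x + h) - weight c x| <= 4 * `|h| * weight c x.
Proof.
move=> c1 h1.
have p0 := weight_den_gt0 x c1; have p1 := weight_den_gt0 (x + h) c1.
have -> : weight c (x + h) - weight c x =
    - (h * (2 * (x + h) - h) * weight c (x + h)) * weight c x.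
  by rewrite /weight; field; rewrite !gt_eqF.
have w0 := weight_gt0 x c1.
rewrite normrM (gtr0_norm w0) ler_pM2r// normrN !normrM (gtr0_norm (weight_gt0 _ c1)).
rewrite -mulrA [leRHS]mulrC ler_wpM2l// /weight ler_pdivrMr//.
have := real_normK (num_real (x + h)).
have := sqr_ge0 (`|x + h| - 1).
have : `|2 * (x + h) - h| <= 2 * `|x + h| + 1.
  by rewrite (le_trans (ler_normB _ _))// normrM (ger0_norm (ler0n _ 2)) lerD2l.
have : 1 <= c ^+ 2 by rewrite expr_ge1//; lra.
nra.
Qed.

Lemma expR_sub_le x y : expR x - expR y <= expR x * (x - y).
Proof.
have := expR_ge1Dx (y - x); rewrite expRD expRN => h.
have e0 := expR_gt0 x.
have : expR x * (1 + (y - x)) <= expR x * (expR y / expR x) by rewrite ler_pM2l.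
rewrite mulrCA divff ?gt_eqF// mulr1; lra.
Qed.

Lemma expR_lipschitz x y Z : x <= Z -> y <= Z ->
  `|expR x - expR y| <= expR Z * `|x - y|.
Proof.
move=> xZ yZ; wlog yx : x y xZ yZ / y <= x => [hw|].
  have [/hw|/ltW/hw] := leP y x; first exact.
  by rewrite distrC (distrC y); exact.
rewrite !ger0_norm ?subr_ge0 ?ler_expR//.
by rewrite (le_trans (expR_sub_le _ _))// ler_wpM2r ?subr_ge0// ler_expR.
Qed.

(** As [lam] grows, [ln (energy lam c G) / lam] approaches the supremum of [G]:
    a growth estimate for the energy with a rate proportional to [lam] is a
    maximum principle for [G]. *)
Definition energy lam c (G : R -> R) : R :=
  \int[mu]_x (expR (lam * G x) * weight c x).

Section step.
Variables (lam c Gam : R) (G0 G1 D m n : R -> R) (Cm Cn : R).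
Hypotheses (lam0 : 0 < lam) (c1 : 1 <= c).
Hypotheses (mG0 : continuous G0) (G0b : forall x, `|G0 x| <= Gam)
  (G1b : forall x, `|G1 x| <= Gam).
Hypotheses (mD : measurable_fun setT D) (D1 : forall x, `|D x| <= 1)
  (aeD : {ae mu, forall x, {for x, continuous D}})
  (G1D : forall x y, x <= y -> G1 y - G1 x = \int[mu]_(z in `]x, y]) D z).
Hypotheses (mm : measurable_fun setT m) (mn : measurable_fun setT n)
  (mb : forall x, `|m x| <= Cm) (nb : forall x, `|n x| <= Cn)
  (cn : forall x, n z @[z --> x^'+] --> n x)
  (mE : forall x y, x <= y ->
    m y - m x = \int[mu]_(z in `]x, y]) (G1 z - G0 z + n z)).

(** The derivative of the energy density with respect to the value of [G1],
    which plays the role of the test function; [dmultiplier] is its derivative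
    in space. *)
Definition multiplier x : R := lam * (expR (lam * G1 x) * weight c x).
Definition dmultiplier x : R :=
  lam * (expR (lam * G1 x) * (lam * D x * weight c x + dweight c x)).

Let G1L x y : `|G1 y - G1 x| <= `|y - x|.
Proof. by have := lipschitz_of_primitive mD D1 G1D x y; rewrite mul1r. Qed.

Let cG1 : continuous G1.
Proof. by apply: (@lipschitz_continuous _ _ 1) => x y; rewrite mul1r. Qed.

Let expb (G : R -> R) x : (forall x, `|G x| <= Gam) -> expR (lam * G x) <= expR (lam * Gam).
Proof. by move=> Gb; rewrite ler_expR ler_pM2l// (le_trans (ler_norm _)). Qed.

Let cexp (G : R -> R) : continuous G -> continuous (fun x => expR (lam * G x) * weight c x).
Proof.
move=> cG x; apply: cvgM; last exact: continuous_weight.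
apply: (@continuous_comp _ _ _ (fun x => lam * G x) expR); last exact: continuous_expR.
by apply: cvgMr; exact: cG.
Qed.

Lemma multiplier_le x : `|multiplier x| <= lam * expR (lam * Gam) * weight c x.
Proof.
have w0 := weight_gt0 x c1.
rewrite ger0_norm; last by rewrite mulr_ge0 ?(ltW lam0)// mulr_ge0 ?expR_ge0// ltW.
by rewrite -mulrA ler_pM2l// ler_pM2r// expb.
Qed.

Lemma dmultiplier_le x :
  `|dmultiplier x| <= lam * expR (lam * Gam) * (lam + 1) * weight c x.
Proof.
have w0 := weight_gt0 x c1.
rewrite !normrM (gtr0_norm lam0) (gtr0_norm (expR_gt0 _)) -!mulrA ler_pM2l//.
apply: ler_pM => //; first exact: expb.
rewrite (le_trans (ler_normD _ _))// mulrDl mul1r lerD//.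
  by rewrite !normrM (gtr0_norm lam0) (gtr0_norm w0) ler_pM2l// ler_piMl// ltW.
rewrite (le_trans (dweight_le _ c1))// ler_piMl// ?(ltW w0)// invf_le1//.
exact: lt_le_trans c1.
Qed.

Lemma continuous_multiplier : continuous multiplier.
Proof. by move=> x; apply: cvgMr; exact: cexp. Qed.

Lemma measurable_dmultiplier : measurable_fun setT dmultiplier.
Proof.
apply: measurable_funM => //; apply: measurable_funM.
  apply: continuous_measurable_fun => x.
  apply: (@continuous_comp _ _ _ (fun x => lam * G1 x) expR); last exact: continuous_expR.
  by apply: cvgMr; exact: cG1.
apply: measurable_funD.
  apply: measurable_funM; first exact: measurable_funM.
  by apply: continuous_measurable_fun; exact: continuous_weight.
apply: continuous_measurable_fun => x; apply: cvgN; apply: cvgM.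
  by apply: cvgMr; exact: cvg_id.
by apply: cvgM; exact: continuous_weight.
Qed.

Lemma integrable_energy (G : R -> R) : continuous G -> (forall x, `|G x| <= Gam) ->
  mu.-integrable setT (EFin \o (fun x => expR (lam * G x) * weight c x)).
Proof.
move=> cG Gb; apply: (@integrable_le_weight _ _ (expR (lam * Gam))).
  by apply: continuous_measurable_fun; exact: cexp.
move=> x; have w0 := weight_gt0 x c1.
rewrite ger0_norm ?mulr_ge0 ?expR_ge0 ?(ltW w0)//.
by apply: ler_pM; rewrite ?expR_ge0 ?(ltW w0) ?expb ?weight_le1.
Qed.

Lemma is_derive_multiplier x : {for x, continuous D} ->
  is_derive x (1 : R) multiplier (dmultiplier x).
Proof.
move=> cD.
have ID := bounded_segment_integrable mD D1.
have dG : is_derive x (1 : R) G1 (D x) by exact: is_derive_prim.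
have dl := is_deriveZ lam dG.
have dE := @is_derive1_comp _ expR (fun x => lam *: G1 x) x _ _ (is_derive_expR _) dl.
have dM := is_deriveZ lam (is_deriveM dE (is_derive_weight x c1)).
have -> : dmultiplier x = lam *: ((expR \o (fun x => lam *: G1 x)) x *: dweight c x
    + weight c x *: (expR (lam *: G1 x) * (lam *: D x))).
  by rewrite /dmultiplier /GRing.scale /=; ring.
exact: dM.
Qed.

Lemma multiplier_shift x h : `|h| <= 1 ->
  `|multiplier (x + h) - multiplier x| <=
  `|h| * (lam * expR (lam * Gam) * (5 * lam + 4) * weight c x).
Proof.
move=> h1; have w0 := weight_gt0 x c1; have w1 := weight_gt0 (x + h) c1.
have e0 := expR_gt0 (lam * Gam).
have ws := weight_shift x c1 h1.
have w5 : weight c (x + h) <= 5 * weight c x.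
  have : `|weight c (x + h) - weight c x| <= 4 * weight c x.
    by apply: (le_trans ws); rewrite ler_pM2r// ler_piMr.
  rewrite ler_norml => /andP[_]; lra.
rewrite /multiplier -mulrBr normrM (gtr0_norm lam0).
rewrite [leRHS](_ : _ = lam * (`|h| * (expR (lam * Gam) * (5 * lam + 4) * weight c x))); last by ring.
rewrite ler_pM2l//.
set a := expR (lam * G1 (x + h)); set b := expR (lam * G1 x).
have -> : a * weight c (x + h) - b * weight c x =
  (a - b) * weight c (x + h) + b * (weight c (x + h) - weight c x) by ring.
rewrite (le_trans (ler_normD _ _))//.
rewrite [leRHS](_ : _ = (expR (lam * Gam) * (lam * `|h|)) * (5 * weight c x)
   + expR (lam * Gam) * (4 * `|h| * weight c x)); last by ring.
rewrite lerD// normrM.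
  rewrite (gtr0_norm w1) ler_pM ?(ltW w1)//.
  have h2 : `|lam * G1 (x + h) - lam * G1 x| <= lam * `|h|.
    rewrite -mulrBr normrM (gtr0_norm lam0) ler_pM2l//.
    by have := G1L x (x + h); rewrite [x + h - x]addrC addKr.
  apply: (@le_trans _ _ (expR (lam * Gam) * `|lam * G1 (x + h) - lam * G1 x|)).
    by apply: expR_lipschitz; rewrite ler_pM2l// (le_trans (ler_norm _)).
  by rewrite ler_pM2l.
by apply: ler_pM => //; rewrite gtr0_norm ?expR_gt0// expb.
Qed.

(** Convexity of the exponential bounds the increment of the energy by the
    integral of [multiplier * (G1 - G0)]; the increment [G1 - G0] is [m' - n], and
    the derivative of [m] is moved to the multiplier by parts. Convexity replaces
    any differentiability in time. *)
Lemma energy_step :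
  energy lam c G1 - energy lam c G0 <=
  \int[mu]_x (- (dmultiplier x * m x) - multiplier x * n x).
Proof.
have l1 : 0 < lam + 1 by rewrite addr_gt0.
have l4 : 0 <= 5 * lam + 4 by rewrite addr_ge0// mulr_ge0// ltW.
have l5 : 1 <= 5 * lam + 5 by rewrite ler_wpDl ?ler1n// mulr_ge0// ltW.
pose q z := G1 z - G0 z + n z.
have Gam0 : 0 <= Gam by rewrite (le_trans _ (G0b 0)).
have Cn0 : 0 <= Cn by rewrite (le_trans _ (nb 0)).
have Cm0 : 0 <= Cm by rewrite (le_trans _ (mb 0)).
have qb x : `|q x| <= 2 * Gam + Cn.
  rewrite (le_trans (ler_normD _ _))// lerD// (le_trans (ler_normB _ _))//.
  by rewrite mulr_natl mulr2n lerD.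
have mG0' : measurable_fun setT G0 by exact: continuous_measurable_fun.
have mG1' : measurable_fun setT G1 by exact: continuous_measurable_fun.
have mq : measurable_fun setT q.
  by apply: measurable_funD => //; exact: measurable_funB.
have Iq : segment_integrable q by exact: bounded_segment_integrable mq qb.
have mmul : measurable_fun setT multiplier.
  by apply: continuous_measurable_fun; exact: continuous_multiplier.
have mdm := measurable_dmultiplier.
set K := lam * expR (lam * Gam).
have K0 : 0 < K by rewrite mulr_gt0// expR_gt0.
have mLip x y : `|m y - m x| <= (2 * Gam + Cn) * `|y - x|.
  exact: lipschitz_of_primitive mq qb mE x y.
have w1c x : 0 < weight 1 x :> R by rewrite weight_gt0.
have wc x : weight c x <= weight 1 x by exact: weight_le1.
have wc0 x : 0 < weight c x by exact: weight_gt0.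
have Q0 : 0 <= 2 * Gam + Cn by rewrite addr_ge0// mulr_ge0.
have S0 : 0 <= Cm + (2 * Gam + Cn) by rewrite addr_ge0.
pose C := K * (5 * lam + 5) * (Cm + (2 * Gam + Cn)).
have ibp : \int[mu]_x (multiplier x * q x) = \int[mu]_x (- (dmultiplier x * m x)).
  apply: (@weighted_ibp _ _ _ _ _ C) => //.
  - move=> x; apply: cvgD; last exact: cn.
    apply: cvgB; apply: cvg_at_right_filter; [exact: cG1|exact: mG0].
  - move=> x; rewrite normrM.
    apply: (@le_trans _ _ (K * weight 1 x * (Cm + (2 * Gam + Cn)))).
      apply: ler_pM => //; last by rewrite (le_trans (mb x))// lerDl.
      by rewrite (le_trans (multiplier_le x))// ler_pM2l.
    rewrite /C mulrAC ler_pM2r// ler_wpM2r//.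
    by rewrite ler_pMr.
  - move=> x h h1; rewrite normrM.
    have := mLip x (x + h); rewrite [x + h - x]addrC addKr => ml.
    apply: (@le_trans _ _ (K * weight 1 x * ((2 * Gam + Cn) * `|h|))).
      apply: ler_pM => //.
      by rewrite (le_trans (multiplier_le x))// ler_pM2l.
    rewrite [leLHS](_ : _ = `|h| * (K * (2 * Gam + Cn) * weight 1 x)); last by ring.
    rewrite ler_wpM2l// ler_pM2r// /C; apply: ler_pM; rewrite ?(ltW K0)//.
    + by rewrite ler_pMr.
    + by rewrite lerDr.
  - move=> x h h1; rewrite normrM.
    apply: (@le_trans _ _ (`|h| * (K * (5 * lam + 4) * weight c x) * Cm)).
      by apply: ler_pM => //; exact: multiplier_shift.
    rewrite -mulrA ler_wpM2l// /C.
    rewrite [leLHS](_ : _ = K * (5 * lam + 4) * Cm * weight c x); last by ring.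
    apply: ler_pM => //.
    + by apply: mulr_ge0 => //; apply: mulr_ge0 => //; exact: ltW.
    + exact: ltW.
    + apply: ler_pM => //; last by rewrite lerDl.
        by apply: mulr_ge0 => //; exact: ltW.
      by rewrite ler_pM2l// lerD2l ler_nat.
  - move: aeD; apply: filterS; first exact: (ae_filter_ringOfSetsType mu).
    by move=> x; exact: is_derive_multiplier.
have Imq : mu.-integrable setT (EFin \o (fun x => multiplier x * q x)).
  apply: (@integrable_le_weight _ _ (K * (2 * Gam + Cn))); first exact: measurable_funM.
  move=> x; rewrite normrM mulrAC; apply: ler_pM => //.
  by rewrite (le_trans (multiplier_le x))// ler_pM2l.
have Imn : mu.-integrable setT (EFin \o (fun x => multiplier x * n x)).
  apply: (@integrable_le_weight _ _ (K * Cn)); first exact: measurable_funM.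
  move=> x; rewrite normrM mulrAC; apply: ler_pM => //.
  by rewrite (le_trans (multiplier_le x))// ler_pM2l.
have Idm : mu.-integrable setT (EFin \o (fun x => - (dmultiplier x * m x))).
  apply: (@integrable_le_weight _ _ (K * (lam + 1) * Cm)).
    by apply: measurableT_comp => //; exact: measurable_funM.
  move=> x; rewrite normrN normrM mulrAC; apply: ler_pM => //.
  by rewrite (le_trans (dmultiplier_le x))// ler_pM2l//; apply: mulr_gt0.
rewrite (RintegralB _ Idm Imn)// -ibp -(RintegralB _ Imq Imn)//.
rewrite /energy -(RintegralB _ (integrable_energy cG1 G1b) (integrable_energy mG0 G0b))//.
have Ie := integrableB measurableT (integrable_energy cG1 G1b) (integrable_energy mG0 G0b).
apply: le_Rintegral => //.
- exact: (integrableB measurableT Imq Imn).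
move=> x _; rewrite -mulrBl.
have -> : multiplier x * q x - multiplier x * n x =
   expR (lam * G1 x) * (lam * G1 x - lam * G0 x) * weight c x.
  by rewrite /multiplier /q; ring.
by rewrite ler_pM2r// expR_sub_le.
Qed.

End step.
End energy.

(** * Paths of distribution functions *)
Section time_integrals.
Context {R : realType}.
Notation mu := (@lebesgue_measure R).
Implicit Types (f A B : R -> R) (H : R -> R -> R) (s t x y z : R).

(** The last two conditions are what weak continuity in time says about
    distribution functions. *)
Definition cdf_path H : Prop :=
  [/\ forall t x, 0 <= H t x <= 1,
      forall t, nondecreasing (H t),
      forall t x, H t z @[z --> x^'+] --> H t x,
      forall x, measurable_fun setT (H ^~ x) &
      forall t x, {for x, continuous (H t)} -> H s x @[s --> t] --> H t x].

Definition time_integral f H t x : R := prim (fun s => f (H s x)) t.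

Section one_path.
Variables (f : R -> R) (L : R) (H : R -> R -> R).
Hypotheses (fL : forall u v, `|f u - f v| <= L * `|u - v|) (hH : cdf_path H).

Let C := `|f 0| + L.

Let L0 : 0 <= L.
Proof. by have := fL 1 0; rewrite subr0 normr1 mulr1; apply: le_trans. Qed.

Lemma lipschitz_path_le t x : `|f (H t x)| <= C.
Proof.
have [/(_ t x) /andP[h0 h1] _ _ _ _] := hH.
rewrite -[f (H t x)](subrK (f 0)) addrC (le_trans (ler_normD _ _))// lerD2l.
by rewrite (le_trans (fL _ _))// subr0 ger0_norm// ler_piMr.
Qed.

Let cf : continuous f.
Proof. by apply: (@lipschitz_continuous _ _ L) => u v; exact: fL. Qed.

Lemma path_segment_integrable x : segment_integrable (fun s => f (H s x)).
Proof.
have [_ _ _ mH _] := hH.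
apply: (@bounded_segment_integrable _ _ C).
  by apply: measurableT_comp => //; exact: continuous_measurable_fun.
by move=> s; exact: lipschitz_path_le.
Qed.

Lemma time_integralB s t x : s <= t -> time_integral f H t x - time_integral f H s x =
  \int[mu]_(r in `]s, t]) f (H r x).
Proof. by move=> st; rewrite /time_integral primB//; exact: path_segment_integrable. Qed.

Lemma time_integral_lip s t x : s <= t ->
  `|time_integral f H t x - time_integral f H s x| <= C * (t - s).
Proof.
move=> st; rewrite time_integralB//; apply: Rintegral_bound => //.
  by have /integrableP[/measurable_EFinP] := path_segment_integrable x s t.
by move=> r _; exact: lipschitz_path_le.
Qed.

Lemma time_integral0 x : time_integral f H 0 x = 0. Proof. exact: prim0. Qed.

Lemma time_integral_right_continuous t x : 0 <= t ->
  time_integral f H t z @[z --> x^'+] --> time_integral f H t x.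
Proof.
move=> t0; have [_ _ rH _ _] := hH.
apply/cvg_at_rightP => u [ux cu].
have E z : time_integral f H t z = \int[mu]_(r in `]0, t]) f (H r z).
  by rewrite -time_integralB// time_integral0 subr0.
rewrite E; under eq_fun do rewrite E.
have mf z : measurable_fun `]0, t] (fun r => f (H r z)).
  by have /integrableP[/measurable_EFinP] := path_segment_integrable z 0 t.
apply: (@Rintegral_dominated_cvg _ _ _ mu _ _ _ (cst C)) => //.
- by move=> n; exact: mf.
- exact: mf.
- apply: aeW => r _; apply: (@cvg_comp _ _ _ (fun n => H r (u n)) f); last exact: cf.
  by have /cvg_at_rightP := rH r x; apply; split.
- by apply: (@bounded_segment_integrable _ _ `|C|).
- by move=> n r _; exact: lipschitz_path_le.
Qed.

Lemma measurable_time_integral t : 0 <= t -> measurable_fun setT (time_integral f H t).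
Proof.
move=> t0; apply: right_continuous_measurable => x.
exact: time_integral_right_continuous.
Qed.

Lemma time_integral_derivative t x (u : nat -> R) :
  {for x, continuous (H t)} -> (forall n, u n < t) -> u n @[n --> \oo] --> t ->
  (t - u n)^-1 * (time_integral f H t x - time_integral f H (u n) x) @[n --> \oo]
    --> f (H t x).
Proof.
move=> cH ut cu; have [_ _ _ _ /(_ t x cH) tH] := hH.
under eq_fun do rewrite (time_integralB _ (ltW (ut _))).
apply: mean_cvg => //; first exact: path_segment_integrable.
move=> e e0.
have cfH : f (H s x) @[s --> t] --> f (H t x).
  by apply: (@cvg_comp _ _ _ (fun s => H s x) f); [exact: tH|exact: cf].
have /cvgrPdist_le /(_ _ e0) [r /= r0 hr] := cfH.
have /cvgrPdist_lt /(_ _ r0) := cu; apply: filterS => n tn y /andP[uy yt].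
rewrite distrC; apply: hr => /=; apply: le_lt_trans tn.
by rewrite !ger0_norm ?subr_ge0 ?(ltW (ut n))// lerD2l lerN2 ltW.
Qed.

End one_path.

(** Convergence in time holds at the points of continuity, hence almost
    everywhere, a nondecreasing function having countably many jumps. *)
Lemma ae_continuous_path H t : cdf_path H ->
  {ae mu, forall x, {for x, continuous (H t)}}.
Proof.
move=> [_ ndH rH _ _].
have ct := nondecreasing_ae_continuous (ndH t) (rH t).
exists [set x | ~ {for x, continuous (H t)}]; split => //.
- exact: countable_measurable.
- exact: countable_lebesgue_measure0.
Qed.

End time_integrals.

(** * Potentials of pairs of paths *)
Section potential.
Context {R : realType}.
Notation mu := (@lebesgue_measure R).
Implicit Types (A B : R -> R) (H G : R -> R -> R) (s t x y z : R).

Definition diffusion_gap A H1 H2 t x : R :=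
  2^-1 * (time_integral A H1 t x - time_integral A H2 t x).
Definition convection_gap B H1 H2 t x : R :=
  time_integral B H1 t x - time_integral B H2 t x.

(** [G t] is the primitive of the difference of the two distribution functions
    that is singled out by the integrated equation
    [d_x (diffusion_gap t) = G t + convection_gap t]. *)
Definition is_potential A B H1 H2 t0 G : Prop := forall t, 0 <= t -> t <= t0 ->
  (forall x y, x <= y ->
     G t y - G t x = \int[mu]_(z in `]x, y]) (H1 t z - H2 t z)) /\
  (forall x y, x <= y ->
     diffusion_gap A H1 H2 t y - diffusion_gap A H1 H2 t x =
     \int[mu]_(z in `]x, y]) (G t z + convection_gap B H1 H2 t z)).

Lemma eq0_of_integrals (f : R -> R) x : segment_integrable f ->
  f z @[z --> x^'+] --> f x ->
  (forall y, x <= y -> \int[mu]_(z in `]x, y]) f z = 0) -> f x = 0.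
Proof.
move=> If cf f0.
have h : (x + n.+1%:R^-1 - x)^-1 * (\int[mu]_(z in `]x, x + n.+1%:R^-1]) f z)
    @[n --> \oo] --> f x.
  apply: (@mean_cvg _ f (f x) (cst x) (fun n => x + n.+1%:R^-1)) => //.
    by move=> n; rewrite ltrDl invr_gt0 ltr0n.
  move=> e e0; have /cvgrPdist_le /(_ _ e0) [r /= r0 hr] := cf.
  have /cvgrPdist_lt /(_ _ r0) := @cvg_harmonic R; apply: filterS => n nr y /andP[xy yn].
  rewrite distrC; apply: hr => //=.
  rewrite distrC gtr0_norm ?subr_gt0// ltrBlDl (le_lt_trans yn)// ltrD2l.
  by move: nr; rewrite /= sub0r normrN gtr0_norm// invr_gt0 ltr0n.
have := cvg_unique (@Rhausdorff R) h (_ : _ --> (0 : R)); apply.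
apply: cvg_near_cst; apply: nearW => n.
by rewrite f0 ?mulr0// lerDl invr_ge0 ler0n.
Qed.

Section bounds.
Variables (A B : R -> R) (LA LB : R) (H1 H2 : R -> R -> R).
Hypotheses (AL : forall u v, `|A u - A v| <= LA * `|u - v|)
  (BL : forall u v, `|B u - B v| <= LB * `|u - v|)
  (h1 : cdf_path H1) (h2 : cdf_path H2).
Let CA := `|A 0| + LA.
Let CB := `|B 0| + LB.
Notation D t := (fun x => H1 t x - H2 t x).
Notation M := (diffusion_gap A H1 H2).
Notation N := (convection_gap B H1 H2).

Lemma cdf_gap_measurable t : measurable_fun setT (D t).
Proof.
have [_ nd1 _ _ _] := h1; have [_ nd2 _ _ _] := h2.
apply: measurable_funB; apply: nondecreasing_measurable => //.
  exact: nd1.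
exact: nd2.
Qed.

Lemma cdf_gap_le1 t x : `|H1 t x - H2 t x| <= 1.
Proof.
have [/(_ t x) /andP[a0 a1] _ _ _ _] := h1.
have [/(_ t x) /andP[b0 b1] _ _ _ _] := h2.
by rewrite ler_norml; apply/andP; split; lra.
Qed.

Lemma cdf_gap_right_continuous t x : D t z @[z --> x^'+] --> D t x.
Proof.
have [_ _ r1 _ _] := h1; have [_ _ r2 _ _] := h2.
by apply: cvgB; [exact: r1|exact: r2].
Qed.

Lemma diffusion_gap_lip s t x : s <= t -> `|M t x - M s x| <= CA * (t - s).
Proof.
move=> st; rewrite /diffusion_gap -mulrBr normrM gtr0_norm ?invr_gt0//.
have := time_integral_lip AL h1 x st; have := time_integral_lip AL h2 x st.
rewrite -/CA => a b; rewrite ler_pdivrMl// mulr_natl mulr2n.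
rewrite (_ : _ - _ = (time_integral A H1 t x - time_integral A H1 s x) -
   (time_integral A H2 t x - time_integral A H2 s x)); last by ring.
by rewrite (le_trans (ler_normB _ _))// lerD.
Qed.

Lemma convection_gap_lip s t x : s <= t -> `|N t x - N s x| <= 2 * CB * (t - s).
Proof.
move=> st; rewrite /convection_gap.
have := time_integral_lip BL h1 x st; have := time_integral_lip BL h2 x st.
rewrite -/CB => a b; rewrite -mulrA mulr_natl mulr2n.
rewrite (_ : _ - _ = (time_integral B H1 t x - time_integral B H1 s x) -
   (time_integral B H2 t x - time_integral B H2 s x)); last by ring.
by rewrite (le_trans (ler_normB _ _))// lerD.
Qed.

Lemma diffusion_gap0 x : M 0 x = 0.
Proof. by rewrite /diffusion_gap !time_integral0 subrr mulr0. Qed.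

Lemma convection_gap0 x : N 0 x = 0.
Proof. by rewrite /convection_gap !time_integral0 subrr. Qed.

Lemma diffusion_gap_right_continuous t x : 0 <= t -> M t z @[z --> x^'+] --> M t x.
Proof.
move=> t0; apply: cvgMr.
by apply: cvgB; [exact: (time_integral_right_continuous AL h1)
  |exact: (time_integral_right_continuous AL h2)].
Qed.

Lemma convection_gap_right_continuous t x : 0 <= t -> N t z @[z --> x^'+] --> N t x.
Proof.
move=> t0; by apply: cvgB; [exact: (time_integral_right_continuous BL h1)
  |exact: (time_integral_right_continuous BL h2)].
Qed.

Lemma measurable_diffusion_gap t : 0 <= t -> measurable_fun setT (M t).
Proof.
by move=> t0; apply: right_continuous_measurable => x; exact: diffusion_gap_right_continuous.
Qed.

Lemma measurable_convection_gap t : 0 <= t -> measurable_fun setT (N t).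
Proof.
by move=> t0; apply: right_continuous_measurable => x; exact: convection_gap_right_continuous.
Qed.

Lemma diffusion_gap_derivative t x (u : nat -> R) :
  {for x, continuous (H1 t)} -> {for x, continuous (H2 t)} ->
  (forall n, u n < t) -> u n @[n --> \oo] --> t ->
  (t - u n)^-1 * (M t x - M (u n) x) @[n --> \oo]
    --> 2^-1 * (A (H1 t x) - A (H2 t x)).
Proof.
move=> c1 c2 ut cu.
have d1 := time_integral_derivative AL h1 c1 ut cu.
have d2 := time_integral_derivative AL h2 c2 ut cu.
rewrite (_ : (fun n => _) = (fun n => 2^-1 *
  ((t - u n)^-1 * (time_integral A H1 t x - time_integral A H1 (u n) x) -
   (t - u n)^-1 * (time_integral A H2 t x - time_integral A H2 (u n) x)))).
  by apply: cvgMr; exact: cvgB.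
by apply/funext => n; rewrite /diffusion_gap; ring.
Qed.

Lemma convection_gap_derivative t x (u : nat -> R) :
  {for x, continuous (H1 t)} -> {for x, continuous (H2 t)} ->
  (forall n, u n < t) -> u n @[n --> \oo] --> t ->
  (t - u n)^-1 * (N t x - N (u n) x) @[n --> \oo]
    --> B (H1 t x) - B (H2 t x).
Proof.
move=> c1 c2 ut cu.
have d1 := time_integral_derivative BL h1 c1 ut cu.
have d2 := time_integral_derivative BL h2 c2 ut cu.
rewrite (_ : (fun n => _) = (fun n =>
  ((t - u n)^-1 * (time_integral B H1 t x - time_integral B H1 (u n) x) -
   (t - u n)^-1 * (time_integral B H2 t x - time_integral B H2 (u n) x)))).
  exact: cvgB.
by apply/funext => n; rewrite /convection_gap; ring.
Qed.

Lemma ae_continuous_cdf_gap t :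
  {ae mu, forall x, {for x, continuous (H1 t)} /\ {for x, continuous (H2 t)}}.
Proof.
have := ae_continuous_path t h1; have := ae_continuous_path t h2.
apply: filterS2; first exact: (ae_filter_ringOfSetsType mu).
by move=> x a b.
Qed.

End bounds.

(** The integrand of the energy derivative at one point, with [d] the gap of
    the distribution functions, [a] and [b] the gaps of their images by [A] and
    [B], [w] and [dw] the weight and its derivative. The diffusion contributes
    [- lam / 2 * d * a], which absorbs the convection up to [delta]; the weight
    costs a term of order [1 / c]. *)
Lemma growth_rate (lam c delta lam0 LA e w dw d a b : R) :
  0 <= lam -> 2 * lam0 <= lam -> 0 < c -> 0 <= e -> 0 <= w ->
  `|dw| <= c^-1 * w -> `|a| <= LA -> 0 <= d * a ->
  `|b| <= delta + lam0 * (d * a) ->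
  - ((lam * (e * (lam * d * w + dw))) * (2^-1 * a)) - (lam * (e * w)) * b
    <= lam * (delta + c^-1 * LA / 2) * (e * w).
Proof.
move=> l0 l02 c0 e0 w0 hdw ha da hb.
have h1 : - (dw * a) <= c^-1 * w * LA.
  rewrite (le_trans (ler_norm _))// normrN normrM.
  by apply: ler_pM.
have h2 : - (w * b) <= w * (delta + lam / 2 * (d * a)).
  rewrite -mulrN ler_wpM2l// (le_trans (ler_norm _))// normrN (le_trans hb)//.
  rewrite lerD2l ler_wpM2r//; lra.
have le0 : 0 <= lam * e by exact: mulr_ge0.
have : lam * e * (- (lam / 2 * (d * a) * w) - dw * a / 2 - w * b) <=
    lam * e * (delta * w + c^-1 * LA / 2 * w).
  apply: ler_wpM2l => //; lra.
lra.
Qed.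

End potential.

(** * Growth of the energy of a potential *)
Section comparison.
Context {R : realType}.
Notation mu := (@lebesgue_measure R).
Implicit Types (A B : R -> R) (H G : R -> R -> R) (s t x y z : R).

(** The mean of [G t] over a unit interval is the increment of a bounded function
    minus the mean of another one, and [G t] is 1-Lipschitz. *)
Lemma potential_bounded A B LA LB H1 H2 t0 G :
  (forall u v, `|A u - A v| <= LA * `|u - v|) ->
  (forall u v, `|B u - B v| <= LB * `|u - v|) ->
  cdf_path H1 -> cdf_path H2 -> 0 <= t0 ->
  is_potential A B H1 H2 t0 G ->
  exists Gam, forall t x, 0 <= t -> t <= t0 -> `|G t x| <= Gam.
Proof.
move=> AL BL h1 h2 t00 pot.
exists (1 + 2 * (`|B 0| + LB) * t0 + 2 * (`|A 0| + LA) * t0) => t x t1 t2.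
have [GD MG] := pot t t1 t2.
have mD := cdf_gap_measurable h1 h2 t.
have D1 := cdf_gap_le1 h1 h2 t.
have GL y z : `|G t z - G t y| <= `|z - y|.
  by have := lipschitz_of_primitive mD D1 GD y z; rewrite mul1r.
have cG : continuous (G t).
  by apply: (@lipschitz_continuous _ _ 1) => y z; rewrite mul1r.
have IG : segment_integrable (G t) by exact: continuous_segment_integrable.
have CA0 : 0 <= `|A 0| + LA.
  have := AL 1 0; rewrite subr0 normr1 mulr1 => h.
  by rewrite addr_ge0// (le_trans _ h).
have CB0 : 0 <= `|B 0| + LB.
  have := BL 1 0; rewrite subr0 normr1 mulr1 => h.
  by rewrite addr_ge0// (le_trans _ h).
have Mb y : `|diffusion_gap A H1 H2 t y| <= (`|A 0| + LA) * t0.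
  have := diffusion_gap_lip AL h1 h2 y t1; rewrite diffusion_gap0 !subr0.
  by move=> /le_trans; apply; rewrite ler_wpM2l.
have Nb y : `|convection_gap B H1 H2 t y| <= 2 * (`|B 0| + LB) * t0.
  have := convection_gap_lip BL h1 h2 y t1; rewrite convection_gap0 !subr0.
  by move=> /le_trans; apply; rewrite ler_wpM2l// mulr_ge0.
have mN := measurable_convection_gap BL h1 h2 t1.
have IN := bounded_segment_integrable mN Nb.
have xx : x <= x + 1 by rewrite lerDl.
have IGN := segment_integrableD IG IN.
have Ic : segment_integrable (cst (G t x)).
  by apply: (@bounded_segment_integrable _ _ `|G t x|).
have e : G t x = (diffusion_gap A H1 H2 t (x + 1) - diffusion_gap A H1 H2 t x)
    - \int[mu]_(z in `]x, x + 1]) (G t z + convection_gap B H1 H2 t z - G t x).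
  rewrite (MG _ _ xx) (RintegralB _ (IGN _ _) (Ic _ _))//.
  rewrite opprB addrC subrK Rintegral_cst//= lebesgue_measure_itv /= lte_fin ltrDl ltr01.
  by rewrite /= addrAC subrr add0r mulr1.
rewrite e.
have h : `|\int[mu]_(z in `]x, x + 1]) (G t z + convection_gap B H1 H2 t z - G t x)|
    <= (1 + 2 * (`|B 0| + LB) * t0) * (x + 1 - x).
  apply: Rintegral_bound => //.
    apply: measurable_funTS; apply: measurable_funB => //; apply: measurable_funD => //.
    exact: continuous_measurable_fun.
  move=> z /andP[xz zx].
  rewrite (_ : _ - _ = (G t z - G t x) + convection_gap B H1 H2 t z); last by ring.
  rewrite (le_trans (ler_normD _ _))// lerD// (le_trans (GL _ _))//.
  by rewrite ger0_norm ?subr_ge0 ?(ltW xz)// lerBlDl.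
rewrite (le_trans (ler_normB _ _))// addrC lerD//.
  by apply: (le_trans h); rewrite [x + 1 - x]addrC addKr mulr1.
rewrite (le_trans (ler_normB _ _))// -mulrA mulr_natl mulr2n lerD//.
Qed.

Lemma potential0 A B LA LB H1 H2 t0 G x :
  (forall u v, `|A u - A v| <= LA * `|u - v|) ->
  (forall u v, `|B u - B v| <= LB * `|u - v|) ->
  cdf_path H1 -> cdf_path H2 -> 0 <= t0 ->
  is_potential A B H1 H2 t0 G -> G 0 x = 0.
Proof.
move=> AL BL h1 h2 t00 pot.
have [GD MG] := pot 0 (lexx _) t00.
have cG : continuous (G 0).
  apply: (@lipschitz_continuous _ _ 1) => y z.
  exact: lipschitz_of_primitive (cdf_gap_measurable h1 h2 0) (cdf_gap_le1 h1 h2 0) GD y z.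
apply: eq0_of_integrals; first exact: continuous_segment_integrable.
  by apply: cvg_at_right_filter; exact: cG.
move=> y xy; have := MG x y xy; rewrite !diffusion_gap0 subrr => e.
by rewrite [RHS]e; apply: eq_Rintegral => z _; rewrite convection_gap0 addr0.
Qed.

(** The increments over [[s, t]] of the time integrals, divided by [t - s],
    converge as [s] increases to [t] to the values at time [t]. The integrand
    given by [energy_step] thus converges to the one estimated by [growth_rate],
    and the comparison lemma concludes. *)
Lemma potential_energy_bound A B LA LB H1 H2 t0 G c delta lam0 lam :
  (forall u v, `|A u - A v| <= LA * `|u - v|) ->
  (forall u v, `|B u - B v| <= LB * `|u - v|) ->
  cdf_path H1 -> cdf_path H2 -> 0 <= t0 ->
  is_potential A B H1 H2 t0 G ->
  1 <= c -> 0 < lam -> 0 <= delta -> 2 * lam0 <= lam ->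
  (forall u v, 0 <= u <= 1 -> 0 <= v <= 1 -> 0 <= (u - v) * (A u - A v)) ->
  (forall u v, 0 <= u <= 1 -> 0 <= v <= 1 ->
    `|B u - B v| <= delta + lam0 * ((u - v) * (A u - A v))) ->
  energy lam c (G t0) <=
  (\int[mu]_x weight c x + 1) * expR ((lam * (delta + c^-1 * LA / 2) + 1) * t0).
Proof.
move=> AL BL h1 h2 t00 pot c1 lam_gt0 del0 laml Amon Bcv.
have LA0 : 0 <= LA by have := AL 1 0; rewrite subr0 normr1 mulr1; apply: le_trans.
have LB0 : 0 <= LB by have := BL 1 0; rewrite subr0 normr1 mulr1; apply: le_trans.
set CA := `|A 0| + LA; set CB := `|B 0| + LB.
have CA0 : 0 <= CA by rewrite addr_ge0.
have CB0 : 0 <= CB by rewrite addr_ge0.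
have [Gam Gb] := potential_bounded AL BL h1 h2 t00 pot.
pose D t x := H1 t x - H2 t x.
have mD t : measurable_fun setT (D t) by exact: cdf_gap_measurable.
have D1 t x : `|D t x| <= 1 by exact: cdf_gap_le1.
have GD t : 0 <= t -> t <= t0 -> forall x y, x <= y ->
    G t y - G t x = \int[mu]_(z in `]x, y]) D t z by move=> a b; have [] := pot t a b.
have cG t : 0 <= t -> t <= t0 -> continuous (G t).
  move=> a b; apply: (@lipschitz_continuous _ _ 1) => y z.
  exact: lipschitz_of_primitive (mD t) (D1 t) (GD t a b) y z.
have aeD t : {ae mu, forall x, {for x, continuous (D t)}}.
  have := ae_continuous_cdf_gap h1 h2 t; apply: filterS.
    exact: (ae_filter_ringOfSetsType mu).
  by move=> x [a b]; apply: cvgB; [exact: a|exact: b].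
set M := diffusion_gap A H1 H2; set N := convection_gap B H1 H2.
pose mult t := multiplier lam c (G t).
pose dmult t := dmultiplier lam c (G t) (D t).
pose K := lam * expR (lam * Gam).
have K0 : 0 < K by rewrite mulr_gt0// expR_gt0.
have lam1 : 0 < lam + 1 by rewrite addr_gt0.
have wc0 x : 0 < weight c x by exact: weight_gt0.
have multb t x : 0 <= t -> t <= t0 -> `|mult t x| <= K * weight 1 x.
  move=> a b; apply: le_trans (multiplier_le lam_gt0 c1 (fun x => Gb t x a b) x) _.
  by rewrite ler_pM2l// weight_le1.
have dmultb t x : 0 <= t -> t <= t0 -> `|dmult t x| <= K * (lam + 1) * weight 1 x.
  move=> a b.
  apply: le_trans (dmultiplier_le lam_gt0 c1 (fun x => Gb t x a b) (D1 t) x) _.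
  by rewrite ler_pM2l ?weight_le1// mulr_gt0.
have mmult t : 0 <= t -> t <= t0 -> measurable_fun setT (mult t).
  move=> a b; apply: continuous_measurable_fun.
  exact: (continuous_multiplier c1 (mD t) (D1 t) (GD t a b)).
have mdmult t : 0 <= t -> t <= t0 -> measurable_fun setT (dmult t).
  by move=> a b; exact: (measurable_dmultiplier lam c1 (mD t) (D1 t) (GD t a b)).
have mM t : 0 <= t -> measurable_fun setT (M t) by exact: measurable_diffusion_gap.
have mN t : 0 <= t -> measurable_fun setT (N t) by exact: measurable_convection_gap.
have Mlip s t x : s <= t -> `|M t x - M s x| <= CA * (t - s) by exact: diffusion_gap_lip.
have Nlip s t x : s <= t -> `|N t x - N s x| <= 2 * CB * (t - s) by exact: convection_gap_lip.
pose Q s t x := - (dmult t x * (M t x - M s x)) - mult t x * (N t x - N s x).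
have mQ s t : 0 <= s -> s <= t -> t <= t0 -> measurable_fun setT (Q s t).
  move=> a b c'; have t1 := le_trans a b.
  apply: measurable_funB.
    apply: measurableT_comp => //; apply: measurable_funM; first exact: mdmult.
    by apply: measurable_funB; exact: mM.
  apply: measurable_funM; first exact: mmult.
  by apply: measurable_funB; exact: mN.
pose C := K * (lam + 1) * CA + K * (2 * CB).
have Qb s t x : 0 <= s -> s <= t -> t <= t0 -> `|Q s t x| <= (t - s) * (C * weight 1 x).
  move=> a b c'; have t1 := le_trans a b.
  rewrite /Q (le_trans (ler_normB _ _))// normrN (normrM (dmult t x)) (normrM (mult t x)).
  rewrite [leRHS](_ : _ = K * (lam + 1) * weight 1 x * (CA * (t - s)) +
    K * weight 1 x * (2 * CB * (t - s))); last by rewrite /C; ring.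
  by apply: lerD; apply: ler_pM => //; solve [exact: dmultb|exact: Mlip|exact: multb|exact: Nlip].
pose E t := energy lam c (G t).
have step s t : 0 <= s -> s <= t -> t <= t0 -> E t - E s <= \int[mu]_x Q s t x.
  move=> s0 st tt0; have t1 := le_trans s0 st; have s1 := le_trans st tt0.
  apply: (@energy_step _ lam c Gam (G s) (G t) (D t) (fun x => M t x - M s x)
    (fun x => N t x - N s x) (CA * (t - s)) (2 * CB * (t - s))) => //.
  - exact: cG.
  - by move=> x; exact: Gb.
  - by move=> x; exact: Gb.
  - exact: GD.
  - by apply: measurable_funB; exact: mM.
  - by apply: measurable_funB; exact: mN.
  - by move=> x; exact: Mlip.
  - by move=> x; exact: Nlip.
  - by move=> x; apply: cvgB; exact: (convection_gap_right_continuous BL h1 h2).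
  - move=> x y xy.
    have [_ MGt] := pot t t1 tt0; have [_ MGs] := pot s s0 s1.
    have IGN r : 0 <= r -> r <= t0 -> segment_integrable (fun z => G r z + N r z).
      move=> r0 r1; apply: segment_integrableD.
        exact/continuous_segment_integrable/cG.
      apply: (@bounded_segment_integrable _ _ (2 * CB * (r - 0))); first exact: mN.
      by move=> z; have := Nlip 0 r z r0; rewrite /N convection_gap0 subr0.
    rewrite (_ : M t y - M s y - (M t x - M s x) = (M t y - M t x) - (M s y - M s x)); last by ring.
    rewrite /M (MGt _ _ xy) (MGs _ _ xy) -(RintegralB _ (IGN _ t1 tt0 _ _) (IGN _ s0 s1 _ _))//.
    by apply: eq_Rintegral => z _; rewrite -/N; ring.
have IQ s t : 0 <= s -> s <= t -> t <= t0 -> mu.-integrable setT (EFin \o Q s t).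
  move=> a b d; apply: (@integrable_le_weight _ _ ((t - s) * C)); first exact: mQ.
  by move=> x; rewrite -mulrA Qb.
pose kap := delta + c^-1 * LA / 2.
have c0 : 0 < c by rewrite (lt_le_trans ltr01).
have kap0 : 0 <= kap by rewrite addr_ge0// divr_ge0// mulr_ge0// invr_ge0 ltW.
have E0 : E 0 = \int[mu]_x weight c x.
  apply: eq_Rintegral => x _.
  by rewrite (potential0 x AL BL h1 h2 t00 pot) mulr0 expR0 mul1r.
rewrite -E0 -/kap; apply: (@one_sided_gronwall R E t0 (C * \int[mu]_x weight 1 x)) => //.
- by rewrite mulr_ge0// ltW.
- by rewrite E0 Rintegral_ge0// => x _; exact: ltW.
- move=> s t s0 st tt0; apply: (le_trans (step s t s0 st tt0)).
  have Iw := @integrable_weight1 R.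
  rewrite mulrC -[C * _]RintegralZl// -RintegralZl//; last first.
    exact: (integrableZl measurableT C Iw).
  apply: le_Rintegral => //; first exact: IQ.
    exact: (integrableZl measurableT (t - s) (integrableZl measurableT C Iw)).
  by move=> x _; rewrite (le_trans (ler_norm _))// Qb.
move=> t eta r t1 tt0 eta0 r0 rt.
pose u n := t - (t - r) / n.+2%:R.
have tr0 : 0 < t - r by rewrite subr_gt0.
have ut n : u n < t by rewrite /u ltrBlDr ltrDl divr_gt0.
have ru n : r < u n.
  by rewrite /u ltrBrDr -ltrBrDl ltr_pdivrMr// ltr_pMr// ltr1n.
have u0 n : 0 <= u n by rewrite (le_trans r0)// ltW.
have cu : u n @[n --> \oo] --> t.
  rewrite -[X in _ --> X]subr0; apply: cvgB; first exact: cvg_cst.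
  rewrite -[X in _ --> X](mulr0 (t - r)); apply: cvgMr.
  by have := @cvg_harmonic R; rewrite -(cvg_shiftS (@harmonic R)).
pose Ql x := - (dmult t x * (2^-1 * (A (H1 t x) - A (H2 t x)))) -
  mult t x * (B (H1 t x) - B (H2 t x)).
have Alip x : `|A (H1 t x) - A (H2 t x)| <= LA.
  by rewrite (le_trans (AL _ _))// ler_piMr// D1.
have Blip x : `|B (H1 t x) - B (H2 t x)| <= LB.
  by rewrite (le_trans (BL _ _))// ler_piMr// D1.
have cA : continuous A by apply: (@lipschitz_continuous _ _ LA) => x y; exact: AL.
have cB : continuous B by apply: (@lipschitz_continuous _ _ LB) => x y; exact: BL.
have mH1 : measurable_fun setT (H1 t).
  by have [_ nd _ _ _] := h1; apply: nondecreasing_measurable => //; exact: nd.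
have mH2 : measurable_fun setT (H2 t).
  by have [_ nd _ _ _] := h2; apply: nondecreasing_measurable => //; exact: nd.
have mQl : measurable_fun setT Ql.
  have mAB (f : R -> R) : continuous f -> measurable_fun setT (fun x : R => f (H1 t x) - f (H2 t x)).
    move=> /continuous_measurable_fun cf.
    by apply: measurable_funB; apply: measurableT_comp.
  apply: measurable_funB.
    apply: measurableT_comp => //; apply: measurable_funM; first exact: mdmult (ltW t1) tt0.
    by apply: measurable_funM => //; exact: mAB.
  by apply: measurable_funM; [exact: mmult (ltW t1) tt0|exact: mAB].
have cvQ : \int[mu]_x ((t - u n)^-1 * Q (u n) t x) @[n --> \oo] --> \int[mu]_x Ql x.
  apply: (@line_dominated_cvg _ _ _ C) => //.
  - by move=> n; apply: measurable_funM => //; apply: mQ => //; exact: ltW.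
  - have := ae_continuous_cdf_gap h1 h2 t; apply: filterS.
      exact: (ae_filter_ringOfSetsType mu).
    move=> x [a b].
    rewrite (_ : (fun n => _) = (fun n => - (dmult t x * ((t - u n)^-1 * (M t x - M (u n) x))) -
       mult t x * ((t - u n)^-1 * (N t x - N (u n) x)))); last first.
      by apply/funext => n; rewrite /Q; ring.
    apply: cvgB; first apply: cvgN; apply: cvgMr.
      exact: (diffusion_gap_derivative AL h1 h2 a b ut cu).
    exact: (convection_gap_derivative BL h1 h2 a b ut cu).
  - move=> n x; have d0 : 0 < t - u n by rewrite subr_gt0.
    rewrite normrM normfV (gtr0_norm d0) ler_pdivrMl//.
    by apply: Qb => //; exact: ltW.
have Ie := integrable_energy lam_gt0 c1 (cG t (ltW t1) tt0) (fun x => Gb t x (ltW t1) tt0).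
have Qle : \int[mu]_x Ql x <= lam * kap * E t.
  rewrite -RintegralZl//; apply: le_Rintegral => //.
  - apply: (@integrable_le_weight _ _ (K * (lam + 1) * LA + K * LB)) => // x.
    rewrite (le_trans (ler_normB _ _))// normrN (normrM (dmult t x)) (normrM (mult t x)) (normrM 2^-1).
    rewrite [leRHS](_ : _ = K * (lam + 1) * weight 1 x * LA + K * weight 1 x * LB); last by ring.
    apply: lerD; apply: ler_pM => //; [exact: dmultb (ltW t1) tt0| |exact: multb (ltW t1) tt0].
    rewrite gtr0_norm ?invr_gt0// ler_pdivrMl// mulr_natl mulr2n (le_trans (Alip x))//.
    by rewrite lerDl.
  - exact: (integrableZl measurableT (lam * kap) Ie).
  move=> x _.
  have [/(_ t x) h1x _ _ _ _] := h1; have [/(_ t x) h2x _ _ _ _] := h2.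
  apply: growth_rate => //.
  - exact: ltW.
  - exact: laml.
  - exact: ltW.
  - exact: dweight_le.
  - exact: Amon.
  - exact: Bcv.
have : \int[mu]_x Ql x < lam * kap * E t + eta by rewrite (le_lt_trans Qle)// ltrDl.
move=> /(cvgr_lt _ cvQ) [n _ /(_ n (leqnn n))] /= hn.
exists (u n); split=> //.
apply: (le_trans (step (u n) t (u0 n) (ltW (ut n)) tt0)).
have d0 : 0 < t - u n by rewrite subr_gt0.
rewrite -ler_pdivrMr// mulrC -RintegralZl ?ltW//.
by apply: IQ => //; exact: ltW.
Qed.

End comparison.

(** * Maximum principle and uniqueness *)
Section uniqueness.
Context {R : realType}.
Notation mu := (@lebesgue_measure R).
Implicit Types (A B : R -> R) (H G : R -> R -> R) (s t x y z : R).

(** As [G] is 1-Lipschitz, [lam * G] loses at most [1] on an interval of length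
    [1 / lam] next to [x0]. *)
Lemma energy_ge lam c (Gam : R) (G : R -> R) x0 : 1 <= lam -> 1 <= c ->
  (forall x y, `|G y - G x| <= `|y - x|) -> (forall x, `|G x| <= Gam) ->
  lam^-1 * (expR (lam * G x0 - 1) * weight c (`|x0| + 1)) <= energy lam c G.
Proof.
move=> lam1 c1 GL Gb.
have lam0 : 0 < lam by rewrite (lt_le_trans ltr01).
have l0 : 0 < lam^-1 by rewrite invr_gt0.
have l1 : lam^-1 <= 1 by rewrite invf_le1.
have cG : continuous G by apply: (@lipschitz_continuous _ _ 1) => x y; rewrite mul1r.
set k := expR _ * _.
have k0 : 0 <= k by rewrite mulr_ge0 ?expR_ge0// ltW// weight_gt0.
have mD : measurable (`]x0, x0 + lam^-1]%classic : set (measurableTypeR R)) by [].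
have Ik : mu.-integrable `]x0, x0 + lam^-1] (EFin \o cst k).
  by apply: (@bounded_segment_integrable _ _ `|k|).
rewrite (_ : _ * k = \int[mu]_(x in `]x0, x0 + lam^-1]) k); last first.
  by rewrite Rintegral_cst//= lebesgue_measure_itv /= lte_fin ltrDl l0 /= addrAC subrr add0r mulrC.
rewrite Rintegral_mkcond; apply: le_Rintegral => //.
- by rewrite -restrict_EFin; apply/integrable_restrict => //=; rewrite setTI.
- exact: integrable_energy.
move=> x _; rewrite patchE; case: ifPn => [|_]; last first.
  by rewrite mulr_ge0 ?expR_ge0// ltW// weight_gt0.
rewrite inE /= in_itv /= => /andP[xx0 xl].
have xd : `|x - x0| <= lam^-1 by rewrite gtr0_norm ?subr_gt0// lerBlDl.
apply: ler_pM; rewrite ?expR_ge0//; first by rewrite ltW// weight_gt0.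
  rewrite ler_expR lerBlDr -lerBlDl -mulrBr.
  apply: (@le_trans _ _ (lam * lam^-1)); last by rewrite divff// gt_eqF.
  rewrite ler_pM2l// (le_trans (ler_norm _))// (le_trans (GL _ _))//.
  by rewrite distrC.
rewrite /weight lef_pV2 ?posrE ?weight_den_gt0// lerD2l.
rewrite -(real_normK (num_real x)) lerXn2r ?nnegrE ?addr_ge0//.
by rewrite -lerBlDl (le_trans (lerB_dist _ _))// (le_trans xd).
Qed.

(** If [G t0 x0 = g] were positive, [delta] and [c] could be chosen so that the
    energy grows at rate at most [lam * g / 2] over the whole time interval. The
    lower bound [exp (lam * g) / lam], up to a constant, then contradicts this
    for [lam] large. *)
Lemma potential_le0 A B LA LB H1 H2 t0 G x0 :
  (forall u v, `|A u - A v| <= LA * `|u - v|) ->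
  (forall u v, `|B u - B v| <= LB * `|u - v|) ->
  {in `[0, 1] &, {homo A : u v / u < v}} ->
  cdf_path H1 -> cdf_path H2 -> 0 <= t0 ->
  is_potential A B H1 H2 t0 G -> G t0 x0 <= 0.
Proof.
move=> AL BL Ainc h1 h2 t00 pot; rewrite leNgt; apply/negP => g0.
set g := G t0 x0 in g0.
have LA0 : 0 <= LA by have := AL 1 0; rewrite subr0 normr1 mulr1; apply: le_trans.
have Amon u v : 0 <= u <= 1 -> 0 <= v <= 1 -> 0 <= (u - v) * (A u - A v).
  move=> u01 v01; have [uv|uv|->] := ltgtP u v; last by rewrite subrr mul0r.
    by rewrite -mulrNN !opprB mulr_ge0// subr_ge0 ltW// Ainc// in_itv.
  by rewrite mulr_ge0// subr_ge0 ltW// Ainc// in_itv.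
have T0 : 0 < 4 * (t0 + 1) by rewrite mulr_gt0// ltr_wpDl.
pose delta := g / (4 * (t0 + 1)).
have d0 : 0 < delta by rewrite divr_gt0.
have [lam0 lam00 Bcv] := convection_le_diffusion AL BL Ainc d0.
pose c := 1 + LA / (2 * delta).
have c1 : 1 <= c by rewrite lerDl divr_ge0// mulr_ge0// ltW.
have c0 : 0 < c by rewrite (lt_le_trans ltr01).
have cLA : c^-1 * LA / 2 <= delta.
  rewrite ler_pdivrMr// mulrC ler_pdivrMr// /c mulrDr mulr1 mulrCA.
  rewrite (_ : LA * _ = LA); first by rewrite lerDr mulr_ge0// ltW.
  by field; rewrite gt_eqF.
have [Gam Gb] := potential_bounded AL BL h1 h2 t00 pot.
have [GD _] := pot t0 t00 (lexx _).
have GL x y : `|G t0 y - G t0 x| <= `|y - x|.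
  have := lipschitz_of_primitive (cdf_gap_measurable h1 h2 t0) (cdf_gap_le1 h1 h2 t0) GD x y.
  by rewrite mul1r.
pose W := \int[mu]_x weight c x.
have W0 : 0 <= W by apply: Rintegral_ge0 => x _; rewrite ltW// weight_gt0.
pose wm := weight c (`|x0| + 1).
have wm0 : 0 < wm by exact: weight_gt0.
pose K := (W + 1) * expR (t0 + 1) / wm.
have K0 : 0 < K by rewrite divr_gt0// mulr_gt0 ?expR_gt0// ltr_wpDl.
(* large enough for the quadratic lower bound of exp (lam * g / 2) to beat
   the linear factor lam * K *)
pose lam := 1 + 2 * lam0 + 8 * K / g ^+ 2.
have q0 : 0 < 8 * K / g ^+ 2 by apply: divr_gt0; [exact: mulr_gt0|exact: exprn_gt0].
have lam1 : 1 <= lam by rewrite /lam; lra.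
have laml : 2 * lam0 <= lam by rewrite /lam; lra.
have lamgt0 : 0 < lam by lra.
have lamK : 8 * K < lam * g ^+ 2.
  by rewrite -ltr_pdivrMr ?exprn_gt0// /lam; lra.
have up := potential_energy_bound AL BL h1 h2 t00 pot c1 lamgt0 (ltW d0) laml Amon Bcv.
have low := energy_ge x0 lam1 c1 GL (fun x => Gb t0 x t00 (lexx _)).
have := le_trans low up.
rewrite -/W -/wm -/g ler_pdivrMl// -ler_pdivlMr//.
have rate : (lam * (delta + c^-1 * LA / 2) + 1) * t0 <= lam * g / 2 + t0.
  rewrite mulrDl mul1r lerD2r -!mulrA ler_pM2l//.
  apply: (@le_trans _ _ (2 * delta * (t0 + 1))).
    apply: ler_pM => //; [|lra|lra].
    apply: addr_ge0; first exact: ltW.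
    by apply: mulr_ge0; [rewrite invr_ge0 ltW|rewrite divr_ge0].
  rewrite (_ : 2 * delta * (t0 + 1) = g / 2)// /delta.
  by field; rewrite gt_eqF// ltr_wpDl.
move=> hh.
have : expR (lam * g - 1) <= expR (lam * g / 2 - 1) * (lam * K).
  apply: (le_trans hh).
  rewrite [leRHS](_ : _ = lam * ((W + 1) * (expR (lam * g / 2 - 1) * expR (t0 + 1))) / wm);
    last by rewrite /K; ring.
  have W1 : 0 < W + 1 by rewrite ltr_wpDl.
  have wv : 0 < wm^-1 by rewrite invr_gt0.
  rewrite (ler_pM2r wv) (ler_pM2l lamgt0) (ler_pM2l W1) -expRD ler_expR.
  lra.
rewrite (_ : lam * g - 1 = (lam * g / 2 - 1) + lam * g / 2); last by field.
rewrite expRD ler_pM2l ?expR_gt0// => h3.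
have lg0 : 0 <= lam * g / 2 by rewrite divr_ge0// mulr_ge0// ltW.
have := expR_ge1Dxn 1 lg0; rewrite (_ : 2`!%:R = 2 :> R)// => h4.
have h5 : lam * (lam * g ^+ 2) <= lam * (8 * K).
  have := le_trans h4 h3; rewrite expr2; lra.
by move: h5; rewrite ler_pM2l// leNgt lamK.
Qed.

(** Exchanging the two paths changes the sign of every term. *)
Lemma is_potentialN A B LA LB H1 H2 t0 G :
  (forall u v, `|A u - A v| <= LA * `|u - v|) ->
  (forall u v, `|B u - B v| <= LB * `|u - v|) ->
  cdf_path H1 -> cdf_path H2 ->
  is_potential A B H1 H2 t0 G ->
  is_potential A B H2 H1 t0 (fun t x => - G t x).
Proof.
move=> AL BL h1 h2 pot t t1 t2; have [GD MG] := pot t t1 t2.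
have mD := cdf_gap_measurable h1 h2 t.
have D1 := cdf_gap_le1 h1 h2 t.
have ID := bounded_segment_integrable mD D1.
have neg f a b : segment_integrable f ->
    - (\int[mu]_(z in `]a, b]) f z) = \int[mu]_(z in `]a, b]) (- f z).
  move=> If; rewrite -mulN1r -(@RintegralZl _ _ _ mu _ f (-1) _ (If a b))//.
  by apply: eq_Rintegral => z _; rewrite mulN1r.
have cG : continuous (G t).
  apply: (@lipschitz_continuous _ _ 1) => y z.
  exact: lipschitz_of_primitive mD D1 GD y z.
have IN : segment_integrable (convection_gap B H1 H2 t).
  apply: (@bounded_segment_integrable _ _ (2 * (`|B 0| + LB) * (t - 0))).
    exact: (measurable_convection_gap BL h1 h2 t1).
  move=> z; have := convection_gap_lip BL h1 h2 z t1.
  by rewrite convection_gap0 [X in `|X| <= _]subr0.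
have IGN := segment_integrableD (continuous_segment_integrable cG) IN.
split=> x y xy.
  rewrite opprK addrC -opprB GD// neg//.
  by apply: eq_Rintegral => z _; rewrite opprB.
have MN z : diffusion_gap A H2 H1 t z = - diffusion_gap A H1 H2 t z.
  by rewrite /diffusion_gap; ring.
rewrite !MN opprK addrC -opprB MG// neg//.
by apply: eq_Rintegral => z _; rewrite /convection_gap; ring.
Qed.

Lemma cdf_path_unique A B LA LB H1 H2 t0 :
  (forall u v, `|A u - A v| <= LA * `|u - v|) ->
  (forall u v, `|B u - B v| <= LB * `|u - v|) ->
  {in `[0, 1] &, {homo A : u v / u < v}} ->
  cdf_path H1 -> cdf_path H2 -> 0 <= t0 ->
  (forall t, 0 <= t -> t <= t0 ->
   forall phi dphi ddphi L, smooth phi ->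
     (forall x, is_derive x (1 : R) phi (dphi x)) ->
     (forall x, is_derive x (1 : R) dphi (ddphi x)) ->
     (forall x, L < `|x| -> [/\ phi x = 0, dphi x = 0 & ddphi x = 0]) ->
     continuous ddphi ->
     \int[mu]_x (phi x * (H1 t x - H2 t x)) =
     \int[mu]_x (ddphi x * diffusion_gap A H1 H2 t x +
                 dphi x * convection_gap B H1 H2 t x)) ->
  forall x, H1 t0 x = H2 t0 x.
Proof.
move=> AL BL Ainc h1 h2 t00 weak.
have mD := cdf_gap_measurable h1 h2.
have D1 := cdf_gap_le1 h1 h2.
have ID t := bounded_segment_integrable (mD t) (D1 t).
have ex t : exists c, 0 <= t -> t <= t0 -> forall x y, x <= y ->
    diffusion_gap A H1 H2 t y - diffusion_gap A H1 H2 t x =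
    \int[mu]_(z in `]x, y]) (c + prim (fun x => H1 t x - H2 t x) z +
      convection_gap B H1 H2 t z).
  have [t1|nt1] := pselect (0 <= t); last by exists 0.
  have [t2|nt2] := pselect (t <= t0); last by exists 0.
  have Mb x : `|diffusion_gap A H1 H2 t x| <= (`|A 0| + LA) * (t - 0).
    by have := diffusion_gap_lip AL h1 h2 x t1; rewrite diffusion_gap0 [X in `|X| <= _]subr0.
  have Nb x : `|convection_gap B H1 H2 t x| <= 2 * (`|B 0| + LB) * (t - 0).
    by have := convection_gap_lip BL h1 h2 x t1; rewrite convection_gap0 [X in `|X| <= _]subr0.
  have rD x : (H1 t z - H2 t z) @[z --> x^'+] --> (H1 t x - H2 t x).
    exact: cdf_gap_right_continuous.
  have rM x : diffusion_gap A H1 H2 t z @[z --> x^'+] --> diffusion_gap A H1 H2 t x.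
    exact: (diffusion_gap_right_continuous AL h1 h2).
  have [c hc] := potential_exists (mD t) (measurable_diffusion_gap AL h1 h2 t1)
    (measurable_convection_gap BL h1 h2 t1) rD rM (D1 t) Mb Nb (weak t t1 t2).
  by exists c.
have [c hc] := choice ex.
pose G t z := c t + prim (fun x => H1 t x - H2 t x) z.
have pot : is_potential A B H1 H2 t0 G.
  move=> t t1 t2; split=> x y xy; last exact: hc.
  by rewrite /G -primB//; ring.
have G0 x : G t0 x = 0.
  apply/eqP; rewrite eq_le (potential_le0 x AL BL Ainc h1 h2 t00 pot) /=.
  have := potential_le0 x AL BL Ainc h2 h1 t00 (is_potentialN AL BL h1 h2 pot).
  by rewrite oppr_le0.
move=> x; apply/eqP; rewrite -subr_eq0; apply/eqP.
apply: (@eq0_of_integrals R (fun x => H1 t0 x - H2 t0 x)) => //.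
  exact: cdf_gap_right_continuous.
move=> y xy; have [<- //] := pot t0 t00 (lexx _).
by rewrite !G0 subrr.
Qed.

End uniqueness.

(** * Distribution functions of weakly continuous paths *)
Section cdf.
Context {R : realType}.
Notation mu := (@lebesgue_measure R).
Implicit Types (P Q : probability (measurableTypeR R) R) (s t x y z : R).

Lemma probability_bounded_integrable P (f : R -> R) C :
  measurable_fun setT (f : measurableTypeR R -> R) -> (forall x, `|f x| <= C) ->
  P.-integrable setT (EFin \o f).
Proof.
move=> mf fC; apply: measurable_bounded_integrable => //.
  by rewrite [X in (X < _)%E]probability_setT ltry.
exists C; split; first exact: num_real.
by move=> M CM x _; exact: le_trans (fC x) (ltW CM).
Qed.

Lemma measurable_step x :
  measurable_fun setT (\1_(`]-oo, x]%classic) : measurableTypeR R -> R).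
Proof. by apply: measurable_indic. Qed.

Lemma HcdfE P x : Hcdf P x = \int[P]_z (\1_(`]-oo, x]%classic) z : R).
Proof.
by rewrite /Hcdf /Rintegral integral_indic// setIT.
Qed.

Lemma indic_le1 (A : set R) z : `|\1_A z : R| <= 1.
Proof. by rewrite indicE; case: (_ \in _); rewrite ?normr1 ?normr0. Qed.

Lemma integrable_step P x :
  P.-integrable setT (EFin \o (\1_(`]-oo, x]%classic) : R -> R)).
Proof.
apply: (@probability_bounded_integrable _ _ 1); first exact: measurable_step.
by move=> z; exact: indic_le1.
Qed.

Lemma Hcdf_ge0 P x : 0 <= Hcdf P x.
Proof. by rewrite fine_ge0. Qed.

Lemma Hcdf_le1 P x : Hcdf P x <= 1.
Proof.
rewrite -[leRHS]/(fine 1%:E) fine_le//; last exact: probability_le1.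
by rewrite fin_num_measure.
Qed.

Lemma Hcdf_nondecreasing P : nondecreasing (Hcdf P).
Proof.
move=> x y xy; rewrite fine_le ?fin_num_measure// le_measure ?inE//.
exact: subitvPr.
Qed.

Lemma Hcdf_right_continuous P x : Hcdf P z @[z --> x^'+] --> Hcdf P x.
Proof.
apply/cvg_at_rightP => u [ux cu]; rewrite HcdfE; under eq_fun do rewrite HcdfE.
apply: (@Rintegral_dominated_cvg _ _ _ P _ _ _ (cst 1)) => //.
- move=> n; exact: measurable_step.
- apply: aeW => z _; apply: cvg_near_cst; have [zx|xz] := leP z x.
    apply: nearW => n; rewrite !indicE !mem_set//= in_itv//=.
    by rewrite (le_trans zx)// ltW.
  near=> n; rewrite !indicE !memNset//= in_itv /= -?ltNge//; apply/negP; rewrite -ltNge//.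
  by near: n; have /cvgr_lt := cu; apply.
- by apply: (@probability_bounded_integrable _ _ 1) => // z; rewrite normr1.
- by move=> n z _; exact: indic_le1.
Unshelve. all: by end_near. Qed.

(** Freezing a path outside [[0, t]] makes it weakly continuous on the whole
    line, with no change on [[0, t]]. *)
Definition clamp t s : R := Num.max 0 (Num.min s t).

Lemma clamp_id t s : 0 <= s -> s <= t -> clamp t s = s.
Proof. by move=> s0 st; rewrite /clamp (min_idPl st) (max_idPr s0). Qed.

Lemma clamp_ge0 t s : 0 <= clamp t s.
Proof. by rewrite /clamp le_max lexx. Qed.

Lemma clamp_le t s : 0 <= t -> clamp t s <= t.
Proof. by move=> t0; rewrite /clamp ge_max t0 ge_min lexx orbT. Qed.

Lemma clamp_lip t u v : `|clamp t u - clamp t v| <= `|u - v|.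
Proof.
wlog vu : u v / v <= u => [hw|].
  have [/hw //|/ltW/hw] := leP v u.
  by rewrite distrC [leRHS]distrC.
rewrite (ger0_norm (_ : 0 <= u - v)) ?subr_ge0// ger0_norm ?subr_ge0.
  by rewrite /clamp /Order.max /Order.min; repeat case: ifPn; rewrite -?leNgt => *; lra.
by rewrite /clamp /Order.max /Order.min; repeat case: ifPn; rewrite -?leNgt => *; lra.
Qed.

Lemma continuous_clamp t : continuous (clamp t).
Proof.
by apply: (@lipschitz_continuous _ _ 1) => x y; rewrite mul1r clamp_lip.
Qed.

(** A continuous function between the indicators of the half-lines ending at
    [x] and at [x + 1 / k]. *)
Definition cut (k : R) x z : R := clamp 1 (1 - k * (z - x)).

Lemma continuous_cut k x : continuous (cut k x).
Proof.
move=> z; apply: (@continuous_comp _ _ _ (fun z => 1 - k * (z - x)) (clamp 1)).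
  apply: cvgB; first exact: cvg_cst; apply: cvgMr.
  by apply: cvgB; [exact: cvg_id|exact: cvg_cst].
exact: continuous_clamp.
Qed.

Lemma cut_norm_le1 k x z : `|cut k x z| <= 1.
Proof. by rewrite ger0_norm ?clamp_ge0 ?clamp_le. Qed.

Definition bc_cut k x : @bounded_continuous R :=
  exist _ (cut k x) (conj (@continuous_cut k x)
    (ex_intro (fun M => forall z, `|cut k x z| <= M) 1 (cut_norm_le1 k x))).

Lemma integrable_cut P k x : P.-integrable setT (EFin \o cut k x).
Proof.
apply: (@probability_bounded_integrable _ _ 1); last exact: cut_norm_le1.
have h : measurable_fun setT (cut k x).
  by apply: continuous_measurable_fun; exact: continuous_cut.
exact: h.
Qed.

Lemma Hcdf_le_cut P k x : 0 <= k -> Hcdf P x <= \int[P]_z cut k x z.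
Proof.
move=> k0; rewrite HcdfE; apply: le_Rintegral => //.
- exact: integrable_step.
- exact: integrable_cut.
move=> z _; rewrite indicE; have [|_] := boolP (z \in _); last exact: clamp_ge0.
rewrite inE /= in_itv /= => zx; rewrite /cut /clamp le_max le_min lexx andbT lerDl oppr_ge0.
by rewrite mulr_ge0_le0 ?orbT// subr_le0.
Qed.

Lemma cut_le_Hcdf P k x : 0 < k -> \int[P]_z cut k x z <= Hcdf P (x + k^-1).
Proof.
move=> k0; rewrite HcdfE; apply: le_Rintegral => //.
- exact: integrable_cut.
- exact: integrable_step.
move=> z _; rewrite indicE; have [_|] := boolP (z \in _); first exact: clamp_le.
rewrite notin_setE /= in_itv /= => /negP; rewrite -ltNge => zx.
rewrite /cut /clamp ge_max lexx ge_min subr_le0 mulrC -ler_pdivrMr// mul1r.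
by rewrite lerBrDl ltW.
Qed.

(** Integrals of the cuts are continuous in time and squeeze the distribution
    function: letting [k] tend to infinity gives measurability in time, and
    continuity in time at the points of continuity in space. *)
Lemma cdf_path_of_weakly_continuous (T : \bar R)
    (P : R -> probability (measurableTypeR R) R) t :
  {within time_interval T, continuous (P : R -> weak_probability R)} ->
  0 <= t -> time_interval T t ->
  cdf_path (fun s x => Hcdf (P (clamp t s)) x).
Proof.
move=> cP t0 [_ tT].
have clT s : time_interval T (clamp t s).
  split; first exact: clamp_ge0.
  by apply: le_lt_trans tT; rewrite lee_fin clamp_le.
have cont k x : continuous (fun s => \int[P (clamp t s)]_z cut k x z).
  move=> s; have /subspace_continuousP cP' := cP.
  have /cvg_weak_probability := cP' (clamp t s) (clT s).
  move=> /(_ (bc_cut k x)) h.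
  apply: (@cvg_comp _ _ _ (clamp t) (fun s => \int[P s]_z cut k x z) _ _ _ _ h).
  move=> U hU.
  have : \forall q \near s, time_interval T (clamp t q) -> U (clamp t q).
    exact: (@continuous_clamp t s _ hU).
  suff hs : (\forall q \near s, time_interval T (clamp t q) -> U (clamp t q)) ->
    \forall q \near s, U (clamp t q) by exact: hs.
  by apply: filterS => q hq; exact: (hq (clT q)).
have rc s x : Hcdf (P s) (x + n.+1%:R^-1) @[n --> \oo] --> Hcdf (P s) x.
  have /cvg_at_rightP := @Hcdf_right_continuous (P s) x; apply; split.
    by move=> n; rewrite ltrDl invr_gt0 ltr0n.
  rewrite -[X in _ --> X]addr0; apply: cvgD; [exact: cvg_cst|exact: cvg_harmonic].
split.
- by move=> s x; rewrite Hcdf_ge0 Hcdf_le1.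
- by move=> s; exact: Hcdf_nondecreasing.
- by move=> s x; exact: Hcdf_right_continuous.
- move=> x; apply: (@measurable_fun_cvg _ _ _ _
    (fun n s => \int[P (clamp t s)]_z cut n.+1%:R x z)).
    by move=> n; apply: continuous_measurable_fun; exact: cont.
  move=> s _; apply: (@squeeze_cvgr _ _ _ _ (cst (Hcdf (P (clamp t s)) x))
    (fun n => Hcdf (P (clamp t s)) (x + n.+1%:R^-1))); last 2 first.
  + exact: cvg_cst.
  + exact: rc.
  by apply: nearW => n /=; rewrite Hcdf_le_cut ?cut_le_Hcdf// ltr0n.
- move=> s x cH; apply/cvgrPdist_le => e e0.
  have /cvgrPdist_le /(_ (e / 2)) := cH.
  rewrite divr_gt0// => /(_ isT) [r /= r0 hr].
  pose d := r / 2; have d0 : 0 < d by rewrite divr_gt0.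
  have dr : d < r by rewrite /d ltr_pdivrMr// mulr_natr mulr2n ltrDl.
  have up : Hcdf (P (clamp t s)) (x + d) <= Hcdf (P (clamp t s)) x + e / 2.
    have := hr (x + d); rewrite /= opprD addrA subrr sub0r normrN gtr0_norm// => /(_ dr).
    by rewrite ler_norml => /andP[h _]; lra.
  have dn : Hcdf (P (clamp t s)) x - e / 2 <= Hcdf (P (clamp t s)) (x - d).
    have := hr (x - d); rewrite /= opprB addrCA subrr addr0 gtr0_norm// => /(_ dr).
    by rewrite ler_norml => /andP[_ h]; lra.
  have kd : 0 < d^-1 by rewrite invr_gt0.
  have e2 : 0 < e / 2 by rewrite divr_gt0.
  have /cvgrPdist_le /(_ _ e2) c1 := cont d^-1 x s.
  have /cvgrPdist_le /(_ _ e2) c2 := cont d^-1 (x - d) s.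
  near=> q.
  have : `|\int[P (clamp t s)]_z cut d^-1 x z - \int[P (clamp t q)]_z cut d^-1 x z| <= e / 2.
    by near: q.
  have : `|\int[P (clamp t s)]_z cut d^-1 (x - d) z - \int[P (clamp t q)]_z cut d^-1 (x - d) z| <= e / 2.
    by near: q.
  have := Hcdf_le_cut (P (clamp t q)) x (ltW kd).
  have := cut_le_Hcdf (P (clamp t q)) (x - d) kd; rewrite invrK subrK.
  have := Hcdf_le_cut (P (clamp t s)) (x - d) (ltW kd).
  have := cut_le_Hcdf (P (clamp t s)) x kd; rewrite invrK.
  rewrite !ler_norml => h1 h2 h3 h4 /andP[h5 h6] /andP[h7 h8].
  by apply/andP; split; lra.
Unshelve. all: by end_near. Qed.

End cdf.

(** * From the weak identity to the potential *)
Section weak_solutions.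
Context {R : realType}.
Notation mu := (@lebesgue_measure R).
Implicit Types (a b f phi : R -> R) (s t x y z u v : R).

Lemma compact_support_integrable f (g : R -> R) (L C : R) : continuous f ->
  (forall x, L < `|x| -> f x = 0) -> measurable_fun setT g ->
  (forall x, `|g x| <= C) ->
  mu.-integrable setT (EFin \o (fun x => f x * g x)).
Proof.
move=> cf f0 mg gC.
have Ig := bounded_segment_integrable mg gC.
have If := segment_integrableM cf Ig.
pose K := `|L| + 1.
have -> : (fun x => f x * g x) = (fun x => f x * g x) \_ `]- K, K].
  apply/funext => x; rewrite patchE; case: ifPn => // /negP xK.
  rewrite f0 ?mul0r// ltNge; apply/negP => xL; apply: xK.
  rewrite inE /= in_itv /= /K.
  have := ler_norm L; have := ler_norm x; have := ler_norm (- x); rewrite normrN.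
  by move=> h1 h2 h3; apply/andP; split; lra.
by rewrite -restrict_EFin; apply/integrable_restrict => //=; rewrite setTI.
Qed.

Lemma integrable_addition f g : mu.-integrable setT (EFin \o f) ->
  mu.-integrable setT (EFin \o g) ->
  mu.-integrable setT (EFin \o (fun x => f x + g x)).
Proof. by move=> If Ig; exact: (integrableD measurableT If Ig). Qed.

(** Distribution functions take their values in the unit interval, so the
    nonlinearities may be extended by constants; the extension is Lipschitz on
    the line. *)
Definition clamped_primitive a u : R := primitive0 a (clamp 1 u).

Lemma clamped_primitive_lipschitz a : {within `[0, 1], continuous a} ->
  exists L, forall u v, `|clamped_primitive a u - clamped_primitive a v| <= L * `|u - v|.
Proof.
move=> ca.
have Ia : mu.-integrable `[0, 1] (EFin \o a).
  by apply: continuous_compact_integrable => //; exact: segment_compact.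
have [|c _ hc] := @EVT_max R (fun z => `|a z|) 0 1 ler01.
  by move=> z; apply: cvg_norm; exact: ca.
exists `|a c| => u v.
apply: (@le_trans _ _ (`|a c| * `|clamp 1 u - clamp 1 v|)); last first.
  by rewrite ler_wpM2l// clamp_lip.
rewrite /clamped_primitive.
have c01 (w : R) : 0 <= clamp 1 w <= 1 by rewrite clamp_ge0 clamp_le.
move: (clamp 1 u) (clamp 1 v) (c01 u) (c01 v) => {}u {}v.
wlog vu : u v / v <= u => [hw|] u01 v01.
  have [vu|/ltW uv] := leP v u; first exact: hw.
  by rewrite distrC (distrC u); exact: hw.
move/andP: u01 => [u0 u1]; move/andP: v01 => [v0 v1].
rewrite (ger0_norm (_ : 0 <= u - v)) ?subr_ge0// /primitive0.
have Iu : mu.-integrable `[0, u] (EFin \o a).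
  by apply: integrableS Ia => //; apply: subset_itvl; rewrite bnd_simp.
rewrite Rintegral_itvB ?bnd_simp//.
have Ivu : mu.-integrable `]v, u] (EFin \o a).
  by apply: integrableS Iu => //; apply: subset_itvr; rewrite bnd_simp.
apply: Rintegral_bound => //; first by have /integrableP[/measurable_EFinP] := Ivu.
move=> z /andP[vz zu]; apply: hc; rewrite in_itv /=; apply/andP; split.
  by rewrite (le_trans v0)// ltW.
exact: le_trans zu u1.
Qed.

Lemma smooth_derive_unique f (d d' : R) x :
  is_derive x (1 : R) f d -> is_derive x (1 : R) f d' -> d = d'.
Proof. by move=> [_ <-] [_ <-]. Qed.

(** On [[0, r]] the cut-off equals [1] and its derivative vanishes, so that the
    term with a time derivative disappears. *)
Lemma weak_identity_tensor a b m T F (P : R -> probability (measurableTypeR R) R)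
    t r t1 t2 phi dphi ddphi :
  {within `[0, 1], continuous a} -> {within `[0, 1], continuous b} ->
  {within time_interval T, continuous (P : R -> weak_probability R)} ->
  (forall s, time_interval T s -> forall x, F s x = Hcdf (P s) x) ->
  time_interval T t -> 0 <= r -> r <= t -> t < t1 -> t1 < t2 ->
  (forall x, is_derive x (1 : R) phi (dphi x)) ->
  (forall x, is_derive x (1 : R) dphi (ddphi x)) ->
  weak_identity a b m F (tensor (cutoff t1 t2) phi) r ->
  let H := fun s x => Hcdf (P (clamp t s)) x in
  \int[mu]_x (phi x * H r x) -
    \int[mu]_x (tensor (cutoff t1 t2) phi (0, x) * Hcdf m x) =
  \int[mu]_x (ddphi x * (2^-1 * time_integral (clamped_primitive a) H r x) +
              dphi x * time_integral (clamped_primitive b) H r x).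
Proof.
move=> ca cb cP FP tT r0 rt tt1 t12 dphiE ddphiE w H.
have [t0 tT'] := tT.
have hH : cdf_path H by exact: cdf_path_of_weakly_continuous cP t0 tT.
have [LA AL] := clamped_primitive_lipschitz ca.
have [LB BL] := clamped_primitive_lipschitz cb.
have FH s x : 0 <= s -> s <= t -> F s x = H s x.
  move=> s0 st; rewrite FP; first by rewrite /H clamp_id.
  by split=> //; apply: le_lt_trans tT'; rewrite lee_fin.
have cF f s x : 0 <= s -> s <= t -> primitive0 f (F s x) = clamped_primitive f (H s x).
  move=> s0 st; rewrite FH// /clamped_primitive clamp_id//; first exact: Hcdf_ge0.
  exact: Hcdf_le1.
have [dcut cutE] : exists dc, forall s, is_derive s (1 : R) (cutoff t1 t2) (dc s).
  by have [dc hdc _] := smooth_cutoff t1 t2 1; exists dc.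
have dcut0 s : s <= t -> dcut s = 0.
  move=> st; apply: (smooth_derive_unique (cutE s)).
  apply: (@near_eq_is_derive _ _ _ (cst (1 : R))).
  near=> q; rewrite cutoff_cst//.
  by near: q; apply: lt_le_nbhsl; exact: le_lt_trans tt1.
move: w; rewrite /weak_identity.
have [_ ->] := tensor_dx (cutoff t1 t2) dphiE.
have [_ ->] := tensor_dx (cutoff t1 t2) ddphiE.
have [_ ->] := tensor_dt phi cutE.
rewrite (_ : \int[mu]_x (tensor _ phi (r, x) * F r x) = \int[mu]_x (phi x * H r x)); last first.
  apply: eq_Rintegral => x _; rewrite /tensor /= cutoff_cst ?mul1r ?FH//.
  by rewrite (le_trans rt)// ltW.
move=> ->; apply: eq_Rintegral => x _.
have IA := path_segment_integrable AL hH x.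
have IB := path_segment_integrable BL hH x.
have cst_cont (k : R) : continuous (fun _ : R => k) by move=> z; exact: cvg_cst.
have IA' := segment_integrableM (cst_cont (2^-1 * ddphi x)) IA.
have IB' := segment_integrableM (cst_cont (dphi x)) IB.
transitivity (\int[mu]_(s in `[0, r])
  (2^-1 * ddphi x * clamped_primitive a (H s x) +
   dphi x * clamped_primitive b (H s x))).
  apply: eq_Rintegral => s; rewrite inE /= in_itv /= => /andP[s0 sr].
  have st := le_trans sr rt.
  rewrite /tensor /= cutoff_cst; [|by []|by rewrite ltW// (le_lt_trans st)].
  rewrite dcut0// !cF//; ring.
rewrite -Rintegral_itv_obnd_cbnd; last exact: (segment_integrableD IA' IB').
rewrite (RintegralD _ (IA' _ _) (IB' _ _))//.
rewrite (RintegralZl _ _ (IA _ _))// (RintegralZl _ _ (IB _ _))//.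
rewrite -(time_integralB AL hH x r0) -(time_integralB BL hH x r0).
by rewrite !time_integral0 !subr0 [2^-1 * _]mulrC -mulrA.
Unshelve. all: by end_near. Qed.

(** In the difference of the two identities the terms at time [0] cancel, which
    leaves the distributional equation satisfied by the potential. *)
Lemma weak_identity_unique (T : \bar R) a b (m : probability (measurableTypeR R) R)
    (F1 F2 : R -> R -> R) :
  {within `[0, 1], continuous a} -> {within `[0, 1], continuous b} ->
  {in `[0, 1] &, {homo primitive0 a : u v / u < v}} ->
  FT T F1 -> FT T F2 ->
  (forall g, test_function T g -> forall t, time_interval T t ->
    weak_identity a b m F1 g t /\ weak_identity a b m F2 g t) ->
  forall t, time_interval T t -> forall x, F1 t x = F2 t x.
Proof.
move=> ca cb Ainc [P1 [cP1 _ _] FP1] [P2 [cP2 _ _] FP2] weak t tT x.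
have [t0 tT'] := tT.
have [tau ttau tauT] : exists2 tau, t < tau & (tau%:E < T)%E.
  case: T tT' {tT weak cP1 cP2 FP1 FP2} => [T0| |] //=.
    rewrite lte_fin => tT0; exists ((t + T0) / 2); rewrite ?lte_fin; lra.
  by move=> _; exists (t + 1); rewrite ?ltry// ltrDl.
pose H1 s x := Hcdf (P1 (clamp t s)) x; pose H2 s x := Hcdf (P2 (clamp t s)) x.
have h1 : cdf_path H1 by exact: cdf_path_of_weakly_continuous cP1 t0 tT.
have h2 : cdf_path H2 by exact: cdf_path_of_weakly_continuous cP2 t0 tT.
have [LA AL] := clamped_primitive_lipschitz ca.
have [LB BL] := clamped_primitive_lipschitz cb.
have Ainc' : {in `[0, 1] &, {homo clamped_primitive a : u v / u < v}}.
  move=> u v u01 v01 uv; move: (u01) (v01); rewrite !in_itv /= => /andP[u0 u1] /andP[v0 v1].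
  by rewrite /clamped_primitive !clamp_id//; exact: Ainc.
rewrite FP1// FP2// -[in LHS](@clamp_id _ t t)// -[in RHS](@clamp_id _ t t)//.
apply: (cdf_path_unique AL BL Ainc' h1 h2 t0) => s s0 st phi dphi ddphi L sphi dE ddE out cdd.
have sT : time_interval T s by split=> //; apply: le_lt_trans tT'; rewrite lee_fin.
set t1 := (t + tau) / 2.
have tt1 : t < t1 by rewrite /t1; lra.
have t1tau : t1 < tau by rewrite /t1; lra.
have test : test_function T (tensor (cutoff t1 tau) phi).
  apply: (@test_function_tensor _ T t1 tau phi L) => //; first by rewrite (le_trans t0)// ltW.
  by move=> z /out[].
have [w1 w2] := weak _ test s sT.
have {w1} := weak_identity_tensor ca cb cP1 FP1 tT s0 st tt1 t1tau dE ddE w1.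
have {w2} := weak_identity_tensor ca cb cP2 FP2 tT s0 st tt1 t1tau dE ddE w2.
rewrite /= -/H1 -/H2 => e2 e1.
have cphi : continuous phi by exact: is_derive_continuous dE.
have cdphi : continuous dphi by exact: is_derive_continuous ddE.
have mcdf H : cdf_path H -> measurable_fun setT (H s).
  by move=> [_ nd _ _ _]; apply: nondecreasing_measurable => //; exact: nd.
have bcdf H z : cdf_path H -> `|H s z| <= 1.
  by move=> [/(_ s z) /andP[h0 hle] _ _ _ _]; rewrite ger0_norm.
have Iphi H : cdf_path H -> mu.-integrable setT (EFin \o (fun z => phi z * H s z)).
  move=> hH; apply: (@compact_support_integrable _ _ L 1) => //.
  - by move=> z /out[].
  - exact: mcdf.
  - by move=> z; exact: bcdf.
have TIb f LF H z : (forall u v, `|f u - f v| <= LF * `|u - v|) -> cdf_path H ->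
    `|time_integral f H s z| <= (`|f 0| + LF) * s.
  by move=> fL hH; have := time_integral_lip fL hH z s0; rewrite time_integral0 !subr0.
have IR H : cdf_path H -> mu.-integrable setT (EFin \o (fun z =>
    ddphi z * (2^-1 * time_integral (clamped_primitive a) H s z) +
    dphi z * time_integral (clamped_primitive b) H s z)).
  move=> hH; apply: integrable_addition.
    apply: (@compact_support_integrable _ _ L (2^-1 * ((`|clamped_primitive a 0| + LA) * s))) => //.
    - by move=> z /out[].
    - by apply: measurable_funM => //; exact: (measurable_time_integral AL hH s0).
    - by move=> z; rewrite normrM gtr0_norm ?invr_gt0// ler_pM2l ?invr_gt0//; exact: TIb.
  apply: (@compact_support_integrable _ _ L ((`|clamped_primitive b 0| + LB) * s)) => //.
  - by move=> z /out[].
  - exact: (measurable_time_integral BL hH s0).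
  - by move=> z; exact: TIb.
transitivity (\int[mu]_z (phi z * H1 s z) - \int[mu]_z (phi z * H2 s z)).
  rewrite -(RintegralB _ (Iphi _ h1) (Iphi _ h2))//.
  by apply: eq_Rintegral => z _; rewrite mulrBr.
transitivity (\int[mu]_z (ddphi z * (2^-1 * time_integral (clamped_primitive a) H1 s z) +
    dphi z * time_integral (clamped_primitive b) H1 s z) -
  \int[mu]_z (ddphi z * (2^-1 * time_integral (clamped_primitive a) H2 s z) +
    dphi z * time_integral (clamped_primitive b) H2 s z)).
  have sub (p q u v c0 : R) : p - c0 = u -> q - c0 = v -> p - q = u - v.
    by move=> <- <-; rewrite opprB addrA subrK.
  exact: (sub _ _ _ _ _ e1 e2).
rewrite -(RintegralB _ (IR _ h1) (IR _ h2))//.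
apply: eq_Rintegral => z _; rewrite /diffusion_gap /convection_gap.
move: (time_integral (clamped_primitive a) H1 s z)
  (time_integral (clamped_primitive a) H2 s z)
  (time_integral (clamped_primitive b) H1 s z)
  (time_integral (clamped_primitive b) H2 s z) => p1 p2 q1 q2.
by ring.
Qed.

End weak_solutions.

Unset Implicit Arguments.
Set Strict Implicit.

Theorem proposition1p2 (R : realType) (a b : R -> R)
    (m : probability (measurableTypeR R) R)
    (a_cont : {within `[0, 1], continuous a})
    (b_cont : {within `[0, 1], continuous b})
    (a_ge0 : forall u, 0 <= u <= 1 -> 0 <= a u)
    (A_incr : {in `[0, 1] &, {homo primitive0 a : u v / u < v}}) :
  (forall (T : \bar R) (F1 F2 : R -> R -> R),
     (0 < T)%E -> FT T F1 -> FT T F2 ->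
     (forall g, test_function T g -> forall t, time_interval T t ->
        weak_identity a b m F1 g t /\ weak_identity a b m F2 g t) ->
     forall t, time_interval T t -> forall x, F1 t x = F2 t x) /\
  (forall F1 F2 : R -> R -> R,
     FT +oo%E F1 -> FT +oo%E F2 ->
     weak_solution a b m F1 -> weak_solution a b m F2 ->
     forall t, time_interval +oo%E t -> forall x, F1 t x = F2 t x).
Proof.
have uniq T F1 F2 := @weak_identity_unique R T a b m F1 F2 a_cont b_cont A_incr.
split=> [T F1 F2 _ FT1 FT2 weak|F1 F2 FT1 FT2 [_ _ w1] [_ _ w2]].
  exact: uniq FT1 FT2 weak.
apply: (uniq _ _ _ FT1 FT2) => g tg t tT.
by split; [exact: w1|exact: w2].
Qed.
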